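(* Let $Z=\{z_n\}$ be a sequence of pairwise distinct points in the unit disc $\mathbb{D}$. Then $Z$ is a sampling sequence for $\mathcal{U}$ if and only if there exists $R>0$ such that $Z$ is $R$-dense in $\mathbb{D}$.
   Context: $\mathcal{U}$ denotes the set of analytic functions $f:\mathbb{D}\to\mathbb{C}$ with $\sup_{z\in\mathbb{D}}|f(z)|\leq 1$. For $z,w\in\mathbb{D}$, $\rho(z,w)=\left|\frac{w-z}{1-\overline{w}z}\right|$ and the hyperbolic distance is $\beta(z,w)=\log\frac{1+\rho(z,w)}{1-\rho(z,w)}$. For $f\in\mathcal{U}$ the hyperbolic derivative is $f^h(z)=\frac{(1-|z|^2)f'(z)}{1-|f(z)|^2}$ and $N(f)=\sup_{z,w\in\mathbb{D},\,z\neq w}\frac{\beta(f(z),f(w))}{\beta(z,w)}=\sup_{z\in\mathbb{D}}|f^h(z)|$ (with $N(f)=0$ for constant $f$). A sequence $Z=\{z_n\}$ is a sampling sequence for $\mathcal{U}$ if there exists a constant $C\in(0,1)$ such that $\sup_{n\neq m}\frac{\beta(f(z_n),f(z_m))}{\beta(z_n,z_m)}\geq C\cdot N(f)$ for every $f\in\mathcal{U}$. $Z$ is $R$-dense in $\mathbb{D}$ if every hyperbolic disc (disc with respect to $\beta$) of radius greater than $R$ contains a point of $Z$. *)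

(* Defs.v *)
From Stdlib Require Import Reals.
From Coquelicot Require Import Coquelicot.
Open Scope R_scope.

Definition in_disc (z : C) : Prop := Cmod z < 1.

(* analytic (= complex differentiable at every point) on the unit disc;
   ex_derive is taken with scalar field C, i.e. complex differentiability *)
Definition analytic_on_disc (f : C -> C) : Prop :=
  forall z : C, in_disc z -> ex_derive f z.

Definition in_U (f : C -> C) : Prop :=
  analytic_on_disc f /\ forall z : C, in_disc z -> Cmod (f z) <= 1.

Definition rho (z w : C) : R :=
  Cmod ((w - z) / (1 - Cconj w * z))%C.

Definition beta (z w : C) : R :=
  ln ((1 + rho z w) / (1 - rho z w)).

Definition N (f : C -> C) : Rbar :=
  Lub_Rbar (fun r => exists z w : C,
    in_disc z /\ in_disc w /\ z <> w /\ r = beta (f z) (f w) / beta z w).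

Definition N_seq (Z : nat -> C) (f : C -> C) : Rbar :=
  Lub_Rbar (fun r => exists n m : nat,
    n <> m /\ r = beta (f (Z n)) (f (Z m)) / beta (Z n) (Z m)).

Definition sampling (Z : nat -> C) : Prop :=
  exists c : R, 0 < c < 1 /\
    forall f : C -> C, in_U f -> Rbar_le (Rbar_mult (Finite c) (N f)) (N_seq Z f).

Definition R_dense (Z : nat -> C) (Rad : R) : Prop :=
  forall (c : C) (r : R), in_disc c -> Rad < r -> exists n : nat, beta (Z n) c < r.

(* Main.v *)
(* Dense implies sampling.  Let [L = N f] and suppose that [f] varies by at most [eta L]
   per unit of hyperbolic distance along the sequence.  Normalise [f] to vanish at a point
   of the sequence.  On a large hyperbolic disc every point has a neighbour in the sequence,
   where [f] is at most a small multiple of [L]; hence [|f| <= M L] with [M] independent of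
   the size of the disc, and each application of Schwarz-Pick on discs of fixed radius
   multiplies this bound by a fixed [theta < 1].  So [f] is as small as wanted compared with
   [L] near the centre, and Schwarz-Pick once more gives
   [beta (f z) (f w) <= L / 2 * beta z w] for near pairs; for distant pairs this follows
   from the triangle inequality.  Hence [L <= L / 2].

   Sampling implies dense.  If a large disc centred at [a] misses the sequence, the Moebius
   map [mob a] sends the sequence close to the unit circle, where Euclidean distances are
   small compared with hyperbolic ones, so [mob a / 8] contradicts sampling.

   Schwarz-Pick itself comes from Goursat's theorem on rectangles, applied to [G(z)/z] in
   the coordinate [log z]: the circle means of [G(z)/z] do not depend on the radius, so
   [|G'(0)| <= 1]; by Moebius invariance this bounds the hyperbolic derivative everywhere,
   and it is then integrated along radii. *)

Require Import Defs.
From Stdlib Require Import Reals Lra Psatz Classical ClassicalEpsilon.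
From Coquelicot Require Import Coquelicot.
Open Scope R_scope.

(** * The pseudo-hyperbolic and hyperbolic distances *)

(** The disc automorphism that carries [a] to 0; its inverse is [mob (- a)]. *)
Definition mob (a z : C) : C := ((z - a) / (1 - Cconj a * z))%C.

Lemma Cmod_sq (z : C) : Cmod z * Cmod z = fst z * fst z + snd z * snd z.
Proof.
  unfold Cmod. rewrite sqrt_sqrt; nra.
Qed.

Lemma Cmod_minus_sym (z w : C) : Cmod (z - w) = Cmod (w - z).
Proof.
  rewrite <- Cmod_opp. f_equal. ring.
Qed.

Lemma Cmod_triangle_rev (z w : C) : Cmod z - Cmod w <= Cmod (z - w).
Proof.
  pose proof (Cmod_triangle (z - w) w) as H.
  replace (z - w + w)%C with z in H by ring. lra.
Qed.

Lemma Cmod_minus_le (z w : C) : Cmod (z - w) <= Cmod z + Cmod w.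
Proof.
  pose proof (Cmod_triangle z (- w)) as H. rewrite Cmod_opp in H. exact H.
Qed.

Lemma Cmod_one_minus (a z : C) :
  1 - Cmod a * Cmod z <= Cmod (1 - Cconj a * z).
Proof.
  pose proof (Cmod_triangle_rev 1 (Cconj a * z)) as H.
  rewrite Cmod_1, Cmod_mult, Cmod_conj in H. exact H.
Qed.

Lemma Cmod_one_minus_le (a z : C) :
  Cmod (1 - Cconj a * z) <= 1 + Cmod a * Cmod z.
Proof.
  pose proof (Cmod_minus_le 1 (Cconj a * z)) as H.
  rewrite Cmod_1, Cmod_mult, Cmod_conj in H. exact H.
Qed.

Lemma den_pos (a z : C) : Cmod a < 1 -> Cmod z <= 1 -> 0 < Cmod (1 - Cconj a * z).
Proof.
  intros Ha Hz. pose proof (Cmod_one_minus a z).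
  pose proof (Cmod_ge_0 a). pose proof (Cmod_ge_0 z). nra.
Qed.

Lemma den_neq0 (a z : C) : Cmod a < 1 -> Cmod z <= 1 -> (1 - Cconj a * z)%C <> 0.
Proof.
  intros Ha Hz. apply Cmod_gt_0. now apply den_pos.
Qed.

(** Dividing by [Cmod (1 - Cconj a * z)] squared turns this into the formula for [1 - rho^2]. It
    shows that [mob a] preserves the disc, and it drives the triangle inequality. *)
Lemma mob_identity (a z : C) :
  Cmod (1 - Cconj a * z) * Cmod (1 - Cconj a * z) - Cmod (z - a) * Cmod (z - a)
  = (1 - Cmod a * Cmod a) * (1 - Cmod z * Cmod z).
Proof.
  rewrite !Cmod_sq. destruct a, z. simpl. ring.
Qed.

Lemma Cmod_mob (a z : C) : Cmod a < 1 -> Cmod z <= 1 ->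
  Cmod (mob a z) = Cmod (z - a) / Cmod (1 - Cconj a * z).
Proof.
  intros Ha Hz. unfold mob. apply Cmod_div. now apply den_neq0.
Qed.

Lemma mob_in_disc (a z : C) : in_disc a -> in_disc z -> in_disc (mob a z).
Proof.
  unfold in_disc. intros Ha Hz. rewrite Cmod_mob by lra.
  pose proof (den_pos a z Ha ltac:(lra)) as Hp. pose proof (mob_identity a z) as Hi.
  apply Rlt_div_l; [exact Hp|].
  pose proof (Cmod_ge_0 a). pose proof (Cmod_ge_0 z). pose proof (Cmod_ge_0 (z - a)).
  assert (0 < (1 - Cmod a * Cmod a) * (1 - Cmod z * Cmod z))
    by (apply Rmult_lt_0_compat; nra).
  nra.
Qed.

Lemma in_disc_opp (a : C) : in_disc a -> in_disc (- a).
Proof. unfold in_disc. now rewrite Cmod_opp. Qed.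

Lemma in_disc_0 : in_disc 0.
Proof. unfold in_disc. rewrite Cmod_0. lra. Qed.

Lemma mob_self (a : C) : mob a a = 0.
Proof.
  unfold mob, Cdiv. replace (a - a)%C with (RtoC 0) by ring. ring.
Qed.

Lemma mob_opp_0 (a : C) : mob (- a) 0 = a.
Proof.
  unfold mob. rewrite Copp_conj. field. 
Qed.

Lemma one_minus_sq_neq0 (a : C) : in_disc a -> (1 - Cconj a * a)%C <> 0.
Proof. intros Ha. apply den_neq0; unfold in_disc in Ha; lra. Qed.

Lemma mob_opp_mob (a z : C) : in_disc a -> in_disc z -> mob (- a) (mob a z) = z.
Proof.
  intros Ha Hz. pose proof (one_minus_sq_neq0 a Ha) as H1.
  assert (H2 : (1 - Cconj a * z)%C <> 0) by (apply den_neq0; unfold in_disc in *; lra).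
  unfold mob. rewrite Copp_conj. field. split; [exact H2|].
  replace (1 - Cconj a * z - - Cconj a * (z - a))%C with (1 - Cconj a * a)%C by ring.
  exact H1.
Qed.

Lemma rho_mob (z w : C) : rho z w = Cmod (mob w z).
Proof.
  unfold rho, mob, Cdiv. rewrite !Cmod_mult. f_equal. apply Cmod_minus_sym.
Qed.

Lemma rho_sym (z w : C) : in_disc z -> in_disc w -> rho z w = rho w z.
Proof.
  unfold in_disc. intros Hz Hw. unfold rho.
  rewrite !Cmod_div by (apply den_neq0; lra).
  rewrite (Cmod_minus_sym w z). f_equal.
  rewrite <- (Cmod_conj (1 - Cconj w * z)). f_equal.
  rewrite Cminus_conj, Cmult_conj, Cconj_conj.
  replace (Cconj 1) with (RtoC 1); [ring|].
  unfold Cconj, RtoC. simpl. f_equal. ring.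
Qed.

Lemma rho_ge0 (z w : C) : 0 <= rho z w.
Proof. apply Cmod_ge_0. Qed.

Lemma rho_lt1 (z w : C) : in_disc z -> in_disc w -> rho z w < 1.
Proof. intros Hz Hw. rewrite rho_mob. now apply mob_in_disc. Qed.

Lemma rho_self (z : C) : rho z z = 0.
Proof.
  unfold rho, Cdiv. rewrite Cmod_mult. replace (z - z)%C with (RtoC 0) by ring.
  rewrite Cmod_0. ring.
Qed.

Lemma rho_0_r (z : C) : rho z 0 = Cmod z.
Proof.
  rewrite rho_mob. unfold mob. f_equal.
  replace (Cconj 0) with (RtoC 0); [field; apply C1_nz|].
  unfold Cconj, RtoC. simpl. f_equal. ring.
Qed.

(** The quotient formed from the images is the original one times [Cconj t / t] with
    [t = 1 - Cconj a * w], a factor of modulus 1. *)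
Lemma rho_mob_invariant (a z w : C) : in_disc a -> in_disc z -> in_disc w ->
  rho (mob a z) (mob a w) = rho z w.
Proof.
  intros Ha Hz Hw.
  assert (Hn : forall u v, in_disc u -> in_disc v -> (1 - Cconj u * v)%C <> 0)
    by (intros u v Hu Hv; apply den_neq0; unfold in_disc in *; lra).
  assert (Hc : Cconj (1 - Cconj a * w) = (1 - a * Cconj w)%C).
  { rewrite Cminus_conj, Cmult_conj, Cconj_conj. f_equal.
    unfold Cconj, RtoC. simpl. f_equal. ring. }
  assert (Hcn : (1 - a * Cconj w)%C <> 0).
  { rewrite <- Hc. apply Cmod_gt_0. rewrite Cmod_conj. apply Cmod_gt_0. now apply Hn. }
  assert (Hcm : Cconj (mob a w) = ((Cconj w - Cconj a) / (1 - a * Cconj w))%C).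
  { unfold mob. rewrite Cdiv_conj by now apply Hn. now rewrite Hc, Cminus_conj. }
  assert (E : ((mob a w - mob a z) / (1 - Cconj (mob a w) * mob a z) =
    (w - z) / (1 - Cconj w * z) * ((1 - a * Cconj w) / (1 - Cconj a * w)))%C).
  { pose proof (Hn (mob a w) (mob a z) (mob_in_disc _ _ Ha Hw) (mob_in_disc _ _ Ha Hz)) as H1.
    rewrite Hcm in H1. rewrite Hcm.
    pose proof (Hn _ _ Ha Hz) as H2. pose proof (Hn _ _ Ha Hw) as H3.
    pose proof (Hn _ _ Hw Hz) as H4. pose proof (Hn _ _ Ha Ha) as H5.
    assert (E2 : (1 - (Cconj w - Cconj a) / (1 - a * Cconj w) * mob a z =
       (1 - Cconj a * a) * (1 - Cconj w * z) / ((1 - Cconj a * z) * (1 - a * Cconj w)))%C).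
    { unfold mob. field. now split. }
    rewrite E2. unfold mob. field. repeat split; assumption. }
  unfold rho at 1. rewrite E, Cmod_mult. fold (rho z w).
  rewrite Cmod_div by now apply Hn. rewrite <- Hc, Cmod_conj.
  assert (0 < Cmod (1 - Cconj a * w)) by (apply Cmod_gt_0; now apply Hn).
  field. lra.
Qed.

Lemma rho_pos (z w : C) : in_disc z -> in_disc w -> z <> w -> 0 < rho z w.
Proof.
  intros Hz Hw Hne. unfold rho.
  assert (Hn : (1 - Cconj w * z)%C <> 0) by (apply den_neq0; unfold in_disc in *; lra).
  rewrite Cmod_div by exact Hn. apply Rdiv_lt_0_compat; apply Cmod_gt_0; [|exact Hn].
  intros E. apply Hne. replace z with (w - (w - z))%C by ring. rewrite E. ring.
Qed.

(** The sharp triangle inequality with middle point 0. The right side is the addition formula of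
    [tanh], so that [hyp] turns it into a sum. *)
Lemma rho_triangle_0 (z w : C) : in_disc z -> in_disc w ->
  rho z w <= (Cmod z + Cmod w) / (1 + Cmod z * Cmod w).
Proof.
  unfold in_disc. intros Hz Hw. unfold rho.
  rewrite Cmod_div by (apply den_neq0; lra).
  pose proof (den_pos w z Hw ltac:(lra)) as Hp.
  pose proof (mob_identity w z) as Hi.
  pose proof (Cmod_triangle_rev z w) as H1. pose proof (Cmod_minus_le w z) as H2.
  rewrite (Cmod_minus_sym z w) in Hi, H1.
  pose proof (Cmod_ge_0 z) as Hz0. pose proof (Cmod_ge_0 w) as Hw0.
  pose proof (Cmod_ge_0 (w - z)) as Hd0.
  set (d := Cmod (w - z)) in *. set (e := Cmod (1 - Cconj w * z)) in *.
  set (x := Cmod z) in *. set (y := Cmod w) in *.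
  assert (Hxy : 0 <= x * y) by nra.
  apply Rle_div_l; [exact Hp|]. unfold Rdiv.
  replace ((x + y) * / (1 + x * y) * e) with ((x + y) * e / (1 + x * y)) by (field; lra).
  apply Rle_div_r; [lra|].
  (* With [e^2 = d^2 + (1-x^2)(1-y^2)], the squares differ by
     [(1-x^2)(1-y^2)((x+y)^2 - d^2)]. *)
  assert (Hq : 0 <= (1 - y * y) * (1 - x * x)) by (apply Rmult_le_pos; nra).
  assert (Hs : (d * (1 + x * y)) * (d * (1 + x * y)) <= ((x + y) * e) * ((x + y) * e)).
  { assert (e * e = d * d + (1 - y * y) * (1 - x * x)) by lra.
    replace (((x + y) * e) * ((x + y) * e)) with ((x + y) * (x + y) * (e * e)) by ring.
    rewrite H.
    assert (0 <= (1 - y * y) * (1 - x * x) * ((x + y) * (x + y) - d * d)).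
    { apply Rmult_le_pos; [exact Hq|]. nra. }
    nra. }
  assert (0 <= (x + y) * e) by (apply Rmult_le_pos; lra).
  assert (0 <= d * (1 + x * y)) by (apply Rmult_le_pos; lra).
  nra.
Qed.

(** By invariance [mob x] may move the middle point to 0. *)
Lemma rho_triangle (z x w : C) : in_disc z -> in_disc x -> in_disc w ->
  rho z w <= (rho z x + rho x w) / (1 + rho z x * rho x w).
Proof.
  intros Hz Hx Hw.
  rewrite (rho_sym x w) by assumption.
  rewrite <- (rho_mob_invariant x z w) by assumption.
  rewrite (rho_mob z x), (rho_mob w x).
  apply rho_triangle_0; now apply mob_in_disc.
Qed.

(** Twice the inverse hyperbolic tangent. *)
Definition hyp (x : R) : R := ln ((1 + x) / (1 - x)).

Lemma beta_hyp (z w : C) : beta z w = hyp (rho z w).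
Proof. reflexivity. Qed.

Lemma hyp_arg_pos (x : R) : -1 < x < 1 -> 0 < (1 + x) / (1 - x).
Proof. intros H. apply Rdiv_lt_0_compat; lra. Qed.

Lemma hyp_0 : hyp 0 = 0.
Proof. unfold hyp. replace ((1 + 0) / (1 - 0)) with 1 by field. apply ln_1. Qed.

Lemma hyp_lt (x y : R) : -1 < x -> x < y -> y < 1 -> hyp x < hyp y.
Proof.
  intros H0 H1 H2. apply ln_increasing; [apply hyp_arg_pos; lra|].
  apply Rlt_div_l; [lra|].
  replace ((1 + y) / (1 - y) * (1 - x)) with ((1 + y) * (1 - x) / (1 - y)) by (field; lra).
  apply Rlt_div_r; [lra|]. nra.
Qed.

Lemma hyp_le (x y : R) : -1 < x -> x <= y -> y < 1 -> hyp x <= hyp y.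
Proof.
  intros H0 [H1| ->] H2; [left; now apply hyp_lt|right; reflexivity].
Qed.

Lemma hyp_inv_le (x y : R) : -1 < y -> x < 1 -> hyp x <= hyp y -> x <= y.
Proof.
  intros Hy Hx H. destruct (Rle_lt_dec x y) as [|Hlt]; [assumption|].
  pose proof (hyp_lt y x Hy Hlt Hx). lra.
Qed.

Lemma hyp_inv_lt (x y : R) : -1 < y -> x < 1 -> -1 < x -> y < 1 -> hyp x < hyp y -> x < y.
Proof.
  intros Hy Hx Hx' Hy' H. destruct (Rle_lt_dec y x) as [Hle|]; [|assumption].
  pose proof (hyp_le y x Hy Hle Hx). lra.
Qed.

Lemma hyp_add (x y : R) : 0 <= x < 1 -> 0 <= y < 1 ->
  hyp ((x + y) / (1 + x * y)) = hyp x + hyp y.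
Proof.
  intros Hx Hy. unfold hyp. rewrite <- ln_mult by (apply hyp_arg_pos; lra).
  assert (0 <= x * y) by nra. f_equal. field. repeat split; nra.
Qed.

Lemma hyp_ge (x : R) : 0 <= x < 1 -> x <= hyp x.
Proof.
  intros Hx. unfold hyp. rewrite <- (ln_exp x) at 1.
  apply ln_le; [apply exp_pos|].
  assert (H : 1 - x <= exp (- x)).
  { pose proof (exp_ineq1_le (- x)). lra. }
  assert (exp x * exp (- x) = 1) by (rewrite <- exp_plus, Rplus_opp_r; apply exp_0).
  pose proof (exp_pos x).
  apply Rle_div_r; [lra|]. nra.
Qed.

(** From [ln t <= t - 1]. Together with [hyp_ge] it makes [beta] and [rho] comparable at small
    distances. *)
Lemma hyp_le_4 (x : R) : 0 <= x <= 1 / 2 -> hyp x <= 4 * x.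
Proof.
  intros Hx. unfold hyp.
  assert (H : ln ((1 + x) / (1 - x)) <= (1 + x) / (1 - x) - 1).
  { pose proof (exp_ineq1_le (ln ((1 + x) / (1 - x)))) as H.
    rewrite exp_ln in H by (apply hyp_arg_pos; lra). lra. }
  eapply Rle_trans; [exact H|].
  replace ((1 + x) / (1 - x) - 1) with (2 * x / (1 - x)) by (field; lra).
  apply Rle_div_l; [lra|]. nra.
Qed.

(* The inverse of [hyp], i.e. [tanh (r / 2)]. *)
Definition hyp_inv (r : R) : R := (exp r - 1) / (exp r + 1).

Lemma hyp_hyp_inv (r : R) : hyp (hyp_inv r) = r.
Proof.
  unfold hyp, hyp_inv. pose proof (exp_pos r).
  replace ((1 + (exp r - 1) / (exp r + 1)) / (1 - (exp r - 1) / (exp r + 1))) with (exp r)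
    by (field; lra).
  apply ln_exp.
Qed.

Lemma hyp_inv_range (r : R) : 0 < r -> 0 < hyp_inv r < 1.
Proof.
  intros Hr. unfold hyp_inv. pose proof (exp_ineq1 r ltac:(lra)).
  split; [apply Rdiv_lt_0_compat; lra|]. apply Rlt_div_l; lra.
Qed.

Lemma hyp_inv_increasing (r s : R) : 0 < r < s -> hyp_inv r < hyp_inv s.
Proof.
  intros H. pose proof (hyp_inv_range r ltac:(lra)). pose proof (hyp_inv_range s ltac:(lra)).
  apply hyp_inv_lt; try lra. rewrite !hyp_hyp_inv. lra.
Qed.

(** * The metric properties of [beta] *)

Lemma beta_sym (z w : C) : in_disc z -> in_disc w -> beta z w = beta w z.
Proof. intros Hz Hw. now rewrite !beta_hyp, rho_sym. Qed.

Lemma beta_self (z : C) : beta z z = 0.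
Proof. rewrite beta_hyp, rho_self. apply hyp_0. Qed.

Lemma beta_ge0 (z w : C) : in_disc z -> in_disc w -> 0 <= beta z w.
Proof.
  intros Hz Hw. rewrite beta_hyp, <- hyp_0. pose proof (rho_ge0 z w).
  pose proof (rho_lt1 z w Hz Hw). apply hyp_le; lra.
Qed.

Lemma beta_pos (z w : C) : in_disc z -> in_disc w -> z <> w -> 0 < beta z w.
Proof.
  intros Hz Hw Hne. rewrite beta_hyp, <- hyp_0.
  pose proof (rho_pos z w Hz Hw Hne). pose proof (rho_lt1 z w Hz Hw). apply hyp_lt; lra.
Qed.

Lemma rho_le_beta (z w : C) : in_disc z -> in_disc w -> rho z w <= beta z w.
Proof.
  intros Hz Hw. apply hyp_ge. split; [apply rho_ge0|now apply rho_lt1].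
Qed.

Lemma beta_triangle (z x w : C) : in_disc z -> in_disc x -> in_disc w ->
  beta z w <= beta z x + beta x w.
Proof.
  intros Hz Hx Hw. rewrite !beta_hyp.
  pose proof (rho_ge0 z x). pose proof (rho_lt1 z x Hz Hx).
  pose proof (rho_ge0 x w). pose proof (rho_lt1 x w Hx Hw).
  pose proof (rho_ge0 z w).
  rewrite <- hyp_add by lra. apply hyp_le; [lra|now apply rho_triangle|].
  assert (0 <= rho z x * rho x w) by nra.
  apply Rlt_div_l; nra.
Qed.

Lemma beta_mob_invariant (a z w : C) : in_disc a -> in_disc z -> in_disc w ->
  beta (mob a z) (mob a w) = beta z w.
Proof. intros. rewrite !beta_hyp. now rewrite rho_mob_invariant. Qed.

(** * Goursat *)

(** The common point is the supremum of the left end points. *)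
Lemma nested_intervals (a b : nat -> R) :
  (forall n, a n <= a (S n)) -> (forall n, b (S n) <= b n) -> (forall n, a n <= b n) ->
  exists u, forall n, a n <= u <= b n.
Proof.
  intros Ha Hb Hab.
  assert (Ha' : forall n k, a n <= a (n + k)%nat).
  { intros n k. induction k as [|k IH]; [rewrite Nat.add_0_r; lra|].
    rewrite Nat.add_succ_r. eapply Rle_trans; [exact IH|apply Ha]. }
  assert (Hb' : forall n k, b (n + k)%nat <= b n).
  { intros n k. induction k as [|k IH]; [rewrite Nat.add_0_r; lra|].
    rewrite Nat.add_succ_r. eapply Rle_trans; [apply Hb|exact IH]. }
  assert (Hall : forall n m, a m <= b n).
  { intros n m. eapply Rle_trans; [apply (Ha' m n)|].
    eapply Rle_trans; [apply Hab|]. rewrite Nat.add_comm. apply Hb'. }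
  destruct (completeness (fun x => exists n, x = a n)) as [u [Hu1 Hu2]].
  - exists (b 0%nat). intros x [n ->]. apply Hall.
  - exists (a 0%nat), 0%nat. reflexivity.
  - exists u. intros n. split; [apply Hu1; now exists n|].
    apply Hu2. intros x [m ->]. apply Hall.
Qed.

(* Rectangles are given by their lower left corner [(a, c)] and their sizes [w], [h]. *)
Lemma bisection_2d (good : R -> R -> R -> R -> Prop) (a0 c0 w0 h0 : R) :
  0 <= w0 -> 0 <= h0 ->
  (forall a c w h, 0 <= w -> 0 <= h ->
     a0 <= a -> a + w <= a0 + w0 -> c0 <= c -> c + h <= c0 + h0 ->
     good a c (w / 2) (h / 2) -> good (a + w / 2) c (w / 2) (h / 2) ->
     good a (c + h / 2) (w / 2) (h / 2) -> good (a + w / 2) (c + h / 2) (w / 2) (h / 2) ->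
     good a c w h) ->
  (forall u v, a0 <= u <= a0 + w0 -> c0 <= v <= c0 + h0 ->
     exists d, 0 < d /\ forall a c w h, 0 <= w < d -> 0 <= h < d ->
       a0 <= a -> a + w <= a0 + w0 -> c0 <= c -> c + h <= c0 + h0 ->
       a <= u <= a + w -> c <= v <= c + h -> good a c w h) ->
  good a0 c0 w0 h0.
Proof.
  intros Hw0 Hh0 Hsplit Hlocal. apply NNPP. intros Hbad0.
  pose (w := fun n => w0 * (1 / 2) ^ n). pose (h := fun n => h0 * (1 / 2) ^ n).
  assert (Hw : forall n, 0 <= w n)
    by (intros n; apply Rmult_le_pos; [lra|apply pow_le; lra]).
  assert (Hh : forall n, 0 <= h n)
    by (intros n; apply Rmult_le_pos; [lra|apply pow_le; lra]).
  assert (HwS : forall n, w (S n) = w n / 2) by (intros n; unfold w; simpl; field).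
  assert (HhS : forall n, h (S n) = h n / 2) by (intros n; unfold h; simpl; field).
  pose (bad := fun n (p : R * R) => ~ good (fst p) (snd p) (w n) (h n) /\
     a0 <= fst p /\ fst p + w n <= a0 + w0 /\ c0 <= snd p /\ snd p + h n <= c0 + h0).
  pose (sub := fun n (p q : R * R) => fst p <= fst q /\ fst q + w (S n) <= fst p + w n /\
     snd p <= snd q /\ snd q + h (S n) <= snd p + h n).
  (* A bad rectangle has a bad quarter. The step is a function on the type of bad corners, so that
     iterating it makes the dependent choices. *)
  assert (step : forall n (p : {p | bad n p}),
    {q : {q | bad (S n) q} | sub n (proj1_sig p) (proj1_sig q)}).
  { intros n [[a c] [Hb Hin]]. simpl in *. apply constructive_indefinite_description.
    pose proof (Hw n). pose proof (Hh n).
    assert (Hex : exists q, bad (S n) q /\ sub n (a, c) q).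
    { unfold bad, sub. rewrite HwS, HhS. simpl.
      apply NNPP. intros Hno. apply Hb. apply Hsplit; try lra;
        apply NNPP; intros Hng; apply Hno.
      - exists (a, c). simpl. split; [split|]; [exact Hng| |]; lra.
      - exists (a + w n / 2, c). simpl. split; [split|]; [exact Hng| |]; lra.
      - exists (a, c + h n / 2). simpl. split; [split|]; [exact Hng| |]; lra.
      - exists (a + w n / 2, c + h n / 2). simpl. split; [split|]; [exact Hng| |]; lra. }
    destruct Hex as [q [Hq1 Hq2]]. now exists (exist _ q Hq1). }
  assert (H0 : bad 0%nat (a0, c0)).
  { unfold bad, w, h. simpl. rewrite !Rmult_1_r. split; [exact Hbad0|lra]. }
  pose (s := nat_rect (fun n => {p | bad n p}) (exist _ _ H0)
               (fun n p => proj1_sig (step n p))).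
  pose (p := fun n => proj1_sig (s n)).
  assert (Hp : forall n, bad n (p n)) by (intros n; exact (proj2_sig (s n))).
  assert (Hsub : forall n, sub n (p n) (p (S n)))
    by (intros n; exact (proj2_sig (step n (s n)))).
  destruct (nested_intervals (fun n => fst (p n)) (fun n => fst (p n) + w n)) as [u Hu];
    try (intros n; pose proof (Hsub n) as Hs; unfold sub in Hs; pose proof (Hw n); lra).
  destruct (nested_intervals (fun n => snd (p n)) (fun n => snd (p n) + h n)) as [v Hv];
    try (intros n; pose proof (Hsub n) as Hs; unfold sub in Hs; pose proof (Hh n); lra).
  destruct (Hlocal u v) as [d [Hd Hgood]].
  { pose proof (Hu 0%nat). pose proof (Hp 0%nat) as Hb. unfold bad in Hb. lra. }
  { pose proof (Hv 0%nat). pose proof (Hp 0%nat) as Hb. unfold bad in Hb. lra. }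
  (* The summand 1 keeps the divisor positive when the rectangle is degenerate. The [n]-th bad
     rectangle contains [(u, v)] and is smaller than [d], so it is good after all. *)
  destruct (pow_lt_1_zero (1 / 2) ltac:(rewrite Rabs_pos_eq; lra) (d / (w0 + h0 + 1)))
    as [n Hn].
  { apply Rdiv_lt_0_compat; lra. }
  specialize (Hn n (le_n n)). rewrite Rabs_pos_eq in Hn by (apply pow_le; lra).
  apply Rlt_div_r in Hn; [|lra].
  assert (0 <= (1 / 2) ^ n) by (apply pow_le; lra).
  destruct (Hp n) as [Hb Hin]. apply Hb. apply Hgood; try apply Hu; try apply Hv; try lra.
  - split; [apply Hw|]. unfold w. nra.
  - split; [apply Hh|]. unfold h. nra.
Qed.

(* The circulation of [P dx + Q dy] along the boundary of a rectangle. *)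
Definition circulation (P Q : R -> R -> R) (a c w h : R) : R :=
  RInt (fun x => P x c - P x (c + h)) a (a + w) +
  RInt (fun y => Q (a + w) y - Q a y) c (c + h).

(** Serves both the affine approximation in Goursat's argument and the estimates of circle means. *)
Lemma RInt_near_const (f : R -> R) (a w K M : R) : 0 <= w -> ex_RInt f a (a + w) ->
  (forall t, a <= t <= a + w -> Rabs (f t - K) <= M) ->
  Rabs (RInt f a (a + w) - K * w) <= M * w.
Proof.
  intros Hw Hf HM.
  assert (E : RInt f a (a + w) - K * w = RInt (fun t => f t - K) a (a + w)).
  { symmetry. apply is_RInt_unique.
    replace (K * w) with (scal (a + w - a) K) by (unfold scal; simpl; unfold mult; simpl; ring).
    apply (is_RInt_minus (V := R_NormedModule)).
    - apply (RInt_correct (V := R_CompleteNormedModule)). exact Hf.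
    - apply (is_RInt_const (V := R_NormedModule)). }
  rewrite E. replace (M * w) with ((a + w - a) * M) by ring.
  apply abs_RInt_le_const; [lra| |exact HM].
  apply (ex_RInt_minus (V := R_NormedModule)); [exact Hf|apply ex_RInt_const].
Qed.

Lemma continuous_slice_x (F : R -> R -> R) (x y lx ly : R) :
  differentiable_pt_lim F x y lx ly -> continuous (fun t => F t y) x.
Proof.
  intros HF. assert (Hc : continuity_2d_pt F x y)
    by (apply differentiable_continuity_pt; now exists lx, ly).
  apply filterlim_locally. intros eps. destruct (Hc eps) as [d Hd].
  exists d. intros t Ht. apply Hd; [exact Ht|].
  rewrite Rminus_diag, Rabs_R0. apply cond_pos.
Qed.

Lemma continuous_slice_y (F : R -> R -> R) (x y lx ly : R) :
  differentiable_pt_lim F x y lx ly -> continuous (fun t => F x t) y.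
Proof.
  intros HF. assert (Hc : continuity_2d_pt F x y)
    by (apply differentiable_continuity_pt; now exists lx, ly).
  apply filterlim_locally. intros eps. destruct (Hc eps) as [d Hd].
  exists d. intros t Ht. apply Hd; [|exact Ht].
  rewrite Rminus_diag, Rabs_R0. apply cond_pos.
Qed.

Section Goursat.

Variables (P Q : R -> R -> R) (a0 c0 w0 h0 : R).
Hypothesis (Hw0 : 0 <= w0) (Hh0 : 0 <= h0).
(** The shared coefficient [p2] says that the partial derivative of [P] in [y] equals that of [Q] in
    [x]. Differentiability is pointwise, which is the setting of Goursat's argument. *)
Hypothesis closed_form : forall x y, a0 <= x <= a0 + w0 -> c0 <= y <= c0 + h0 ->
  exists p1 p2 q2, differentiable_pt_lim P x y p1 p2 /\ differentiable_pt_lim Q x y p2 q2.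

Lemma ex_RInt_P (a w y : R) : 0 <= w -> a0 <= a -> a + w <= a0 + w0 ->
  c0 <= y <= c0 + h0 -> ex_RInt (fun x => P x y) a (a + w).
Proof.
  intros Hw Ha Haw Hy. apply (ex_RInt_continuous (V := R_CompleteNormedModule)).
  intros x Hx. rewrite Rmin_left, Rmax_right in Hx by lra.
  destruct (closed_form x y) as [p1 [p2 [q2 [H1 H2]]]]; [lra..|].
  eapply continuous_slice_x; exact H1.
Qed.

Lemma ex_RInt_Q (c h x : R) : 0 <= h -> c0 <= c -> c + h <= c0 + h0 ->
  a0 <= x <= a0 + w0 -> ex_RInt (fun y => Q x y) c (c + h).
Proof.
  intros Hh Hc Hch Hx. apply (ex_RInt_continuous (V := R_CompleteNormedModule)).
  intros y Hy. rewrite Rmin_left, Rmax_right in Hy by lra.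
  destruct (closed_form x y) as [p1 [p2 [q2 [H1 H2]]]]; [lra..|].
  eapply continuous_slice_y; exact H2.
Qed.

Lemma circulation_eq (a c w h : R) : 0 <= w -> 0 <= h ->
  a0 <= a -> a + w <= a0 + w0 -> c0 <= c -> c + h <= c0 + h0 ->
  circulation P Q a c w h =
    RInt (fun x => P x c) a (a + w) - RInt (fun x => P x (c + h)) a (a + w) +
    (RInt (fun y => Q (a + w) y) c (c + h) - RInt (fun y => Q a y) c (c + h)).
Proof.
  intros. unfold circulation. f_equal.
  - apply (RInt_minus (V := R_CompleteNormedModule)); apply ex_RInt_P; lra.
  - apply (RInt_minus (V := R_CompleteNormedModule)); apply ex_RInt_Q; lra.
Qed.

(** The edges inside the rectangle are traversed twice in opposite directions and cancel. *)
Lemma circulation_split (a c w h : R) : 0 <= w -> 0 <= h ->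
  a0 <= a -> a + w <= a0 + w0 -> c0 <= c -> c + h <= c0 + h0 ->
  circulation P Q a c w h =
    circulation P Q a c (w / 2) (h / 2) + circulation P Q (a + w / 2) c (w / 2) (h / 2) +
    circulation P Q a (c + h / 2) (w / 2) (h / 2) +
    circulation P Q (a + w / 2) (c + h / 2) (w / 2) (h / 2).
Proof.
  intros. rewrite !circulation_eq by lra.
  replace (a + w / 2 + w / 2) with (a + w) by field.
  replace (c + h / 2 + h / 2) with (c + h) by field.
  assert (HP : forall y, c0 <= y <= c0 + h0 -> RInt (fun x => P x y) a (a + w) =
    RInt (fun x => P x y) a (a + w / 2) + RInt (fun x => P x y) (a + w / 2) (a + w)).
  { intros y Hy. symmetry. apply (RInt_Chasles (V := R_CompleteNormedModule)).
    - apply ex_RInt_P; lra.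
    - replace (a + w) with (a + w / 2 + w / 2) by field. apply ex_RInt_P; lra. }
  assert (HQ : forall x, a0 <= x <= a0 + w0 -> RInt (fun y => Q x y) c (c + h) =
    RInt (fun y => Q x y) c (c + h / 2) + RInt (fun y => Q x y) (c + h / 2) (c + h)).
  { intros x Hx. symmetry. apply (RInt_Chasles (V := R_CompleteNormedModule)).
    - apply ex_RInt_Q; lra.
    - replace (c + h) with (c + h / 2 + h / 2) by field. apply ex_RInt_Q; lra. }
  rewrite !HP, !HQ by lra. ring.
Qed.

(** Near [(u, v)] the form is affine and closed up to an error of order [eps * (w + h)], and this
    error is integrated along edges of lengths [w] and [h]. *)
Lemma circulation_small (u v eps : R) : 0 < eps ->
  a0 <= u <= a0 + w0 -> c0 <= v <= c0 + h0 ->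
  exists d, 0 < d /\ forall a c w h, 0 <= w < d -> 0 <= h < d ->
    a0 <= a -> a + w <= a0 + w0 -> c0 <= c -> c + h <= c0 + h0 ->
    a <= u <= a + w -> c <= v <= c + h ->
    Rabs (circulation P Q a c w h) <= eps * ((w + h) * (w + h)).
Proof.
  intros Heps Hu Hv.
  destruct (closed_form u v Hu Hv) as [p1 [p2 [q2 [HP HQ]]]].
  assert (He2 : 0 < eps / 2) by lra.
  destruct (HP (mkposreal _ He2)) as [d1 Hd1]. destruct (HQ (mkposreal _ He2)) as [d2 Hd2].
  simpl in Hd1, Hd2.
  exists (Rmin d1 d2). split; [apply Rmin_pos; apply cond_pos|].
  intros a c w h Hw Hh Ha Haw Hc Hch Hua Hvc.
  pose proof (Rmin_l d1 d2). pose proof (Rmin_r d1 d2).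
  assert (Hmax : forall x y, a <= x <= a + w -> c <= y <= c + h ->
    Rmax (Rabs (x - u)) (Rabs (y - v)) <= w + h).
  { intros x y Hx Hy. apply Rmax_lub; apply Rabs_le; lra. }
  assert (BP : forall x y, a <= x <= a + w -> c <= y <= c + h ->
    Rabs (P x y - P u v - (p1 * (x - u) + p2 * (y - v))) <= eps / 2 * (w + h)).
  { intros x y Hx Hy. eapply Rle_trans; [apply Hd1; apply Rabs_lt_between; lra|].
    apply Rmult_le_compat_l; [lra|now apply Hmax]. }
  assert (BQ : forall x y, a <= x <= a + w -> c <= y <= c + h ->
    Rabs (Q x y - Q u v - (p2 * (x - u) + q2 * (y - v))) <= eps / 2 * (w + h)).
  { intros x y Hx Hy. eapply Rle_trans; [apply Hd2; apply Rabs_lt_between; lra|].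
    apply Rmult_le_compat_l; [lra|now apply Hmax]. }
  (* The affine part contributes [- p2 h w + p2 w h = 0]. *)
  assert (IP : Rabs (RInt (fun x => P x c - P x (c + h)) a (a + w) - (- p2 * h) * w)
               <= eps * (w + h) * w).
  { apply RInt_near_const; [lra| |].
    - apply (ex_RInt_minus (V := R_NormedModule)); apply ex_RInt_P; lra.
    - intros x Hx. pose proof (BP x c Hx ltac:(lra)) as B1.
      pose proof (BP x (c + h) Hx ltac:(lra)) as B2.
      apply Rabs_le_between in B1. apply Rabs_le_between in B2. apply Rabs_le_between. lra. }
  assert (IQ : Rabs (RInt (fun y => Q (a + w) y - Q a y) c (c + h) - (p2 * w) * h)
               <= eps * (w + h) * h).
  { apply RInt_near_const; [lra| |].
    - apply (ex_RInt_minus (V := R_NormedModule)); apply ex_RInt_Q; lra.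
    - intros y Hy. pose proof (BQ a y ltac:(lra) Hy) as B1.
      pose proof (BQ (a + w) y ltac:(lra) Hy) as B2.
      apply Rabs_le_between in B1. apply Rabs_le_between in B2. apply Rabs_le_between. lra. }
  unfold circulation.
  apply Rabs_le_between in IP. apply Rabs_le_between in IQ. apply Rabs_le_between. lra.
Qed.

(** The bound [eps * (w + h)^2] is additive over the four quarters, so bisection carries it from
    small rectangles to the whole one, for every [eps]. *)
Lemma goursat : circulation P Q a0 c0 w0 h0 = 0.
Proof.
  assert (H : forall eps, 0 < eps ->
    Rabs (circulation P Q a0 c0 w0 h0) <= eps * ((w0 + h0) * (w0 + h0))).
  { intros eps Heps.
    apply (bisection_2d (fun a c w h =>
      Rabs (circulation P Q a c w h) <= eps * ((w + h) * (w + h)))); try assumption.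
    - intros a c w h Hw Hh Ha Haw Hc Hch H1 H2 H3 H4.
      rewrite circulation_split by assumption.
      apply Rabs_le_between in H1. apply Rabs_le_between in H2.
      apply Rabs_le_between in H3. apply Rabs_le_between in H4.
      apply Rabs_le_between. lra.
    - intros u v Hu Hv. now apply circulation_small. }
  apply NNPP. intros Hne. apply Rabs_pos_lt in Hne.
  set (J := Rabs (circulation P Q a0 c0 w0 h0)) in *.
  set (K := (w0 + h0) * (w0 + h0)) in *.
  assert (HK : 0 <= K) by (unfold K; nra).
  specialize (H (J / (2 * (K + 1)))).
  assert (HJ : 0 < J / (2 * (K + 1))) by (apply Rdiv_lt_0_compat; lra).
  specialize (H HJ).
  assert (J / (2 * (K + 1)) * (2 * (K + 1)) = J) by (field; lra). nra.
Qed.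

End Goursat.

(** * Complex derivatives *)

(** Complex differentiability in little-o form: without a quotient, the case [w = z] needs no
    exception. *)
Definition cder (f : C -> C) (z l : C) : Prop :=
  forall eps, 0 < eps -> exists d, 0 < d /\ forall w, Cmod (w - z) < d ->
    Cmod (f w - f z - l * (w - z)) <= eps * Cmod (w - z).

Lemma is_derive_cder (f : C -> C) (z l : C) :
  @is_derive C_AbsRing C_NormedModule f z l <-> cder f z l.
Proof.
  split.
  - intros [_ H] eps Heps.
    destruct (H z ltac:(intros P HP; exact HP) (mkposreal eps Heps)) as [d Hd].
    exists d. split; [apply cond_pos|]. intros w Hw.
    rewrite Cmult_comm. exact (Hd w Hw).
  - intros H. split; [apply is_linear_scal_l|].
    intros x Hx.
    apply (is_filter_lim_locally_unique (V := AbsRing_NormedModule C_AbsRing)) in Hx.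
    subst x. intros eps.
    destruct (H eps (cond_pos eps)) as [d [Hd Hw]].
    exists (mkposreal d Hd). intros w Hwd. specialize (Hw w Hwd).
    rewrite Cmult_comm in Hw. exact Hw.
Qed.

Lemma cder_lipschitz (f : C -> C) (z l : C) : cder f z l ->
  exists d, 0 < d /\ forall w, Cmod (w - z) < d ->
    Cmod (f w - f z) <= (Cmod l + 1) * Cmod (w - z).
Proof.
  intros H. destruct (H 1 ltac:(lra)) as [d [Hd Hw]]. exists d. split; [exact Hd|].
  intros w Hwd. specialize (Hw w Hwd).
  replace (f w - f z)%C with ((f w - f z - l * (w - z)) + l * (w - z))%C by ring.
  eapply Rle_trans; [apply Cmod_triangle|]. rewrite Cmod_mult. lra.
Qed.

Lemma cder_affine (a b z : C) : cder (fun w => a * w + b)%C z a.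
Proof.
  intros eps Heps. exists 1. split; [lra|]. intros w _.
  replace (a * w + b - (a * z + b) - a * (w - z))%C with (RtoC 0) by ring.
  rewrite Cmod_0. pose proof (Cmod_ge_0 (w - z)). nra.
Qed.

Lemma cder_mult (f g : C -> C) (z l m : C) : cder f z l -> cder g z m ->
  cder (fun w => f w * g w)%C z (l * g z + f z * m)%C.
Proof.
  intros Hf Hg eps Heps.
  pose proof (Cmod_ge_0 (f z)) as Hfz. pose proof (Cmod_ge_0 (g z)) as Hgz.
  pose proof (Cmod_ge_0 l) as Hl.
  pose proof (Cmod_ge_0 m) as Hm.
  (* [K] is the sum of the coefficients of [e * h] in the bounds [B1], [B2] and [B3] below. *)
  set (K := Cmod (f z) + Cmod (g z) + Cmod l + 1).
  assert (HK : 0 < K) by (unfold K; lra).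
  set (e := eps / K). assert (He : 0 < e) by (apply Rdiv_lt_0_compat; assumption).
  assert (HeK : e * K = eps) by (unfold e; field; lra).
  destruct (Hf e He) as [d1 [Hd1 H1]]. destruct (Hg e He) as [d2 [Hd2 H2]].
  destruct (cder_lipschitz g z m Hg) as [d3 [Hd3 H3]].
  (* By the Lipschitz bound, [Cmod (w - z) < r] keeps [g w] within [Rmin 1 e] of [g z]. *)
  set (r := Rmin 1 e / (Cmod m + 1)).
  assert (Hr : 0 < r) by (apply Rdiv_lt_0_compat; [apply Rmin_pos; lra|lra]).
  exists (Rmin (Rmin d1 d2) (Rmin d3 r)). split; [repeat apply Rmin_pos; assumption|].
  intros w Hw.
  assert (Hw1 : Cmod (w - z) < d1 /\ Cmod (w - z) < d2 /\ Cmod (w - z) < d3 /\ Cmod (w - z) < r).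
  { repeat split; (eapply Rlt_le_trans; [exact Hw|]);
    unfold Rmin; repeat destruct (Rle_dec _ _); lra. }
  destruct Hw1 as [W1 [W2 [W3 W4]]].
  specialize (H1 w W1). specialize (H2 w W2). specialize (H3 w W3).
  unfold r in W4. apply Rlt_div_r in W4; [|lra].
  assert (Hgw : Cmod (g w - g z) <= Rmin 1 e) by lra.
  assert (Hgw1 : Cmod (g w - g z) <= 1) by (eapply Rle_trans; [exact Hgw|apply Rmin_l]).
  assert (Hgw2 : Cmod (g w - g z) <= e) by (eapply Rle_trans; [exact Hgw|apply Rmin_r]).
  pose proof (Cmod_triangle (g w - g z) (g z)) as Hgwz.
  replace (g w - g z + g z)%C with (g w) in Hgwz by ring.
  replace (f w * g w - f z * g z - (l * g z + f z * m) * (w - z))%C with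
    ((f w - f z - l * (w - z)) * g w + f z * (g w - g z - m * (w - z))
      + l * (w - z) * (g w - g z))%C by ring.
  eapply Rle_trans; [apply Cmod_triangle|].
  eapply Rle_trans; [apply Rplus_le_compat_r, Cmod_triangle|].
  rewrite !Cmod_mult.
  pose proof (Cmod_ge_0 (w - z)) as Hh. set (h := Cmod (w - z)) in *.
  assert (B1 : Cmod (f w - f z - l * (w - z)) * Cmod (g w) <= (e * h) * (Cmod (g z) + 1)).
  { apply Rmult_le_compat; try apply Cmod_ge_0; lra. }
  assert (B2 : Cmod (f z) * Cmod (g w - g z - m * (w - z)) <= Cmod (f z) * (e * h))
    by (apply Rmult_le_compat_l; lra).
  assert (B3 : Cmod l * h * Cmod (g w - g z) <= Cmod l * h * e).
  { apply Rmult_le_compat_l; [apply Rmult_le_pos; lra|lra]. }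
  rewrite <- HeK. unfold K. lra.
Qed.

Lemma cder_comp (f g : C -> C) (z l m : C) : cder f (g z) l -> cder g z m ->
  cder (fun w => f (g w)) z (l * m)%C.
Proof.
  intros Hf Hg eps Heps.
  pose proof (Cmod_ge_0 l) as Hl. pose proof (Cmod_ge_0 m) as Hm.
  (* The remainder of [f] costs [e * (Cmod m + 1) * h] and that of [g] costs [Cmod l * e * h]. *)
  set (K := Cmod l + Cmod m + 1). assert (HK : 0 < K) by (unfold K; lra).
  set (e := eps / K). assert (He : 0 < e) by (apply Rdiv_lt_0_compat; assumption).
  assert (HeK : e * K = eps) by (unfold e; field; lra).
  destruct (Hf e He) as [d1 [Hd1 H1]]. destruct (Hg e He) as [d2 [Hd2 H2]].
  destruct (cder_lipschitz g z m Hg) as [d3 [Hd3 H3]].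
  set (r := d1 / (Cmod m + 1)). assert (Hr : 0 < r) by (apply Rdiv_lt_0_compat; lra).
  exists (Rmin d2 (Rmin d3 r)). split; [repeat apply Rmin_pos; assumption|].
  intros w Hw.
  assert (Hw1 : Cmod (w - z) < d2 /\ Cmod (w - z) < d3 /\ Cmod (w - z) < r).
  { repeat split; (eapply Rlt_le_trans; [exact Hw|]);
    unfold Rmin; repeat destruct (Rle_dec _ _); lra. }
  destruct Hw1 as [W2 [W3 W4]].
  specialize (H2 w W2). specialize (H3 w W3).
  unfold r in W4. apply Rlt_div_r in W4; [|lra].
  specialize (H1 (g w) ltac:(lra)).
  replace (f (g w) - f (g z) - l * m * (w - z))%C with
    ((f (g w) - f (g z) - l * (g w - g z)) + l * (g w - g z - m * (w - z)))%C by ring.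
  eapply Rle_trans; [apply Cmod_triangle|]. rewrite Cmod_mult.
  pose proof (Cmod_ge_0 (w - z)) as Hh. set (h := Cmod (w - z)) in *.
  assert (B1 : e * Cmod (g w - g z) <= e * ((Cmod m + 1) * h))
    by (apply Rmult_le_compat_l; lra).
  assert (B2 : Cmod l * Cmod (g w - g z - m * (w - z)) <= Cmod l * (e * h))
    by (apply Rmult_le_compat_l; lra).
  rewrite <- HeK. unfold K. lra.
Qed.

Lemma cder_inv (z : C) : z <> 0 -> cder Cinv z (- / (z * z))%C.
Proof.
  intros Hz eps Heps. pose proof (proj1 (Cmod_gt_0 z) Hz) as Hr. set (r := Cmod z) in *.
  (* The remainder is [(w - z)^2 / (z^2 * w)]. The first bound gives [Cmod w >= r / 2], and the
     second then makes the remainder at most [eps * h]. *)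
  exists (Rmin (r / 2) (eps * (r * r * r) / 2)).
  assert (Hr3 : 0 < r * r * r) by (repeat apply Rmult_lt_0_compat; assumption).
  split; [apply Rmin_pos; [lra|]; apply Rdiv_lt_0_compat; [nra|lra]|].
  intros w Hw.
  assert (Hw1 : Cmod (w - z) < r / 2) by (eapply Rlt_le_trans; [exact Hw|apply Rmin_l]).
  assert (Hw2 : Cmod (w - z) < eps * (r * r * r) / 2)
    by (eapply Rlt_le_trans; [exact Hw|apply Rmin_r]).
  pose proof (Cmod_triangle_rev z (z - w)) as Ht.
  replace (z - (z - w))%C with w in Ht by ring.
  rewrite (Cmod_minus_sym z w) in Ht. fold r in Ht.
  assert (Hwp : 0 < Cmod w) by lra.
  assert (Hw0 : w <> 0) by now apply Cmod_gt_0.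
  replace (/ w - / z - - / (z * z) * (w - z))%C with
    ((w - z) * (w - z) / (z * z * w))%C by (field; split; assumption).
  rewrite Cmod_div by (repeat apply Cmult_neq_0; assumption).
  rewrite !Cmod_mult. fold r. pose proof (Cmod_ge_0 (w - z)) as Hh.
  set (h := Cmod (w - z)) in *.
  apply Rle_div_l; [repeat apply Rmult_lt_0_compat; assumption|].
  assert (r * r * (r / 2) <= r * r * Cmod w) by (apply Rmult_le_compat_l; nra).
  assert (eps * h * (r * r * (r / 2)) <= eps * h * (r * r * Cmod w))
    by (apply Rmult_le_compat_l; nra).
  nra.
Qed.

(** Product and chain rule for [w - a] times the inverse of an affine function; the result is then
    transferred to [mob a] value by value. *)
Lemma cder_mob (a z : C) : in_disc a -> in_disc z ->
  cder (mob a) z ((1 - Cconj a * a) / ((1 - Cconj a * z) * (1 - Cconj a * z)))%C.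
Proof.
  intros Ha Hz.
  assert (Hn : (1 - Cconj a * z)%C <> 0) by (apply den_neq0; unfold in_disc in *; lra).
  replace ((1 - Cconj a * a) / ((1 - Cconj a * z) * (1 - Cconj a * z)))%C with
    (1 * / (- Cconj a * z + 1) +
     (1 * z + - a) * (- / ((- Cconj a * z + 1) * (- Cconj a * z + 1)) * - Cconj a))%C.
  - intros eps Heps.
    assert (H1 : cder (fun w => (1 * w + - a) * / (- Cconj a * w + 1))%C z
      (1 * / (- Cconj a * z + 1) +
       (1 * z + - a) * (- / ((- Cconj a * z + 1) * (- Cconj a * z + 1)) * - Cconj a))%C).
    { apply (cder_mult (fun w => 1 * w + - a)%C (fun w => / (- Cconj a * w + 1))%C).
      - apply cder_affine.
      - apply (cder_comp Cinv (fun w => - Cconj a * w + 1)%C).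
        + apply cder_inv. replace (- Cconj a * z + 1)%C with (1 - Cconj a * z)%C by ring.
          exact Hn.
        + apply cder_affine. }
    destruct (H1 eps Heps) as [d [Hd Hw]]. exists d. split; [exact Hd|].
    intros w Hwd. specialize (Hw w Hwd). unfold mob, Cdiv.
    replace ((w - a) * / (1 - Cconj a * w))%C with ((1 * w + - a) * / (- Cconj a * w + 1))%C
      by (f_equal; [ring|f_equal; ring]).
    replace ((z - a) * / (1 - Cconj a * z))%C with ((1 * z + - a) * / (- Cconj a * z + 1))%C
      by (f_equal; [ring|f_equal; ring]).
    exact Hw.
  - replace (- Cconj a * z + 1)%C with (1 - Cconj a * z)%C by ring. field. exact Hn.
Qed.

(** * The complex exponential and the Cauchy-Riemann equations *)

Definition Cexp (z : C) : C := (exp (fst z) * cos (snd z), exp (fst z) * sin (snd z)).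

Lemma Cexp_plus (z w : C) : Cexp (z + w) = (Cexp z * Cexp w)%C.
Proof.
  destruct z as [x y], w as [u v]. unfold Cexp, Cplus, Cmult. simpl.
  rewrite exp_plus, cos_plus, sin_plus. f_equal; ring.
Qed.

Lemma Cexp_0 : Cexp 0 = 1.
Proof.
  unfold Cexp, RtoC. simpl. rewrite exp_0, cos_0, sin_0. f_equal; ring.
Qed.

Lemma Cmod_Cexp (z : C) : Cmod (Cexp z) = exp (fst z).
Proof.
  pose proof (exp_pos (fst z)) as He. pose proof (Cmod_ge_0 (Cexp z)).
  pose proof (Cmod_sq (Cexp z)) as Hs. unfold Cexp at 3 4 5 6 in Hs. simpl in Hs.
  pose proof (sin2_cos2 (snd z)) as Hsc. unfold Rsqr in Hsc.
  assert (Cmod (Cexp z) * Cmod (Cexp z) = exp (fst z) * exp (fst z)).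
  { rewrite Hs.
    replace (exp (fst z) * cos (snd z) * (exp (fst z) * cos (snd z)) +
      exp (fst z) * sin (snd z) * (exp (fst z) * sin (snd z))) with
      (exp (fst z) * exp (fst z) * (sin (snd z) * sin (snd z) + cos (snd z) * cos (snd z)))
      by ring.
    rewrite Hsc. ring. }
  nra.
Qed.

Lemma derivable_at_0 (f : R -> R) (l eps : R) : derivable_pt_lim f 0 l -> 0 < eps ->
  exists d, 0 < d /\ forall h, Rabs h < d -> Rabs (f h - f 0 - l * h) <= eps * Rabs h.
Proof.
  intros H Heps. destruct (H eps Heps) as [d Hd]. exists d. split; [apply cond_pos|].
  intros h Hh. destruct (Req_dec h 0) as [->|Hne].
  - replace (f 0 - f 0 - l * 0) with 0 by ring. rewrite Rabs_R0. lra.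
  - specialize (Hd h Hne Hh). rewrite Rplus_0_l in Hd.
    replace (f h - f 0 - l * h) with (((f h - f 0) / h - l) * h) by (field; exact Hne).
    rewrite Rabs_mult. apply Rmult_le_compat_r; [apply Rabs_pos|lra].
Qed.

Lemma Cmod_le_abs (z : C) : Cmod z <= Rabs (fst z) + Rabs (snd z).
Proof.
  pose proof (Cmod_sq z). pose proof (Rabs_pos (fst z)). pose proof (Rabs_pos (snd z)).
  pose proof (Cmod_ge_0 z). pose proof (Rsqr_abs (fst z)).
  pose proof (Rsqr_abs (snd z)). unfold Rsqr in *. nra.
Qed.

Lemma abs_fst_le (z : C) : Rabs (fst z) <= Cmod z.
Proof. eapply Rle_trans; [|apply Rmax_Cmod]. apply Rmax_l. Qed.

Lemma abs_snd_le (z : C) : Rabs (snd z) <= Cmod z.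
Proof. eapply Rle_trans; [|apply Rmax_Cmod]. apply Rmax_r. Qed.

Lemma cder_Cexp_0 : cder Cexp 0 1.
Proof.
  intros eps Heps. set (e := Rmin 1 (eps / 8)).
  assert (He : 0 < e) by (apply Rmin_pos; lra).
  assert (He1 : e <= 1) by apply Rmin_l. assert (He8 : e <= eps / 8) by apply Rmin_r.
  destruct (derivable_at_0 exp 1 e) as [d1 [Hd1 H1]];
    [rewrite <- exp_0; apply derivable_pt_lim_exp|exact He|].
  destruct (derivable_at_0 sin 1 e) as [d2 [Hd2 H2]];
    [rewrite <- cos_0; apply derivable_pt_lim_sin|exact He|].
  destruct (derivable_at_0 cos 0 e) as [d3 [Hd3 H3]];
    [replace 0 with (- sin 0) at 2 by (rewrite sin_0; ring); apply derivable_pt_lim_cos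
    |exact He|].
  rewrite exp_0 in H1. rewrite sin_0 in H2. rewrite cos_0 in H3.
  exists (Rmin (Rmin d1 d2) (Rmin d3 e)). split; [repeat apply Rmin_pos; lra|].
  intros w Hw. rewrite Cexp_0.
  replace (w - 0)%C with w in * by ring. replace (1 * w)%C with w by ring.
  pose proof (abs_fst_le w) as A1. pose proof (abs_snd_le w) as A2.
  assert (Hw1 : Cmod w < d1 /\ Cmod w < d2 /\ Cmod w < d3 /\ Cmod w < e).
  { repeat split; (eapply Rlt_le_trans; [exact Hw|]);
    unfold Rmin; repeat destruct (Rle_dec _ _); lra. }
  clear Hw. destruct w as [x y]. simpl in *.
  set (m := Cmod (x, y)) in *.
  specialize (H1 x ltac:(lra)). specialize (H2 y ltac:(lra)). specialize (H3 y ltac:(lra)).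
  eapply Rle_trans; [apply Cmod_le_abs|]. simpl.
  pose proof (Rabs_pos x). pose proof (Rabs_pos y).
  assert (Hm : 0 <= m) by (apply Cmod_ge_0).
  assert (B1 : Rabs (exp x - 1 - 1 * x) <= e * m) by nra.
  assert (B2 : Rabs (sin y - 0 - 1 * y) <= e * m) by nra.
  assert (B3 : Rabs (cos y - 1 - 0 * y) <= e * m) by nra.
  assert (Bx : Rabs (exp x - 1) <= 2 * m).
  { replace (exp x - 1) with ((exp x - 1 - 1 * x) + x) by ring.
    eapply Rle_trans; [apply Rabs_triang|]. nra. }
  assert (By : Rabs (sin y) <= 2 * e).
  { replace (sin y) with ((sin y - 0 - 1 * y) + y) by ring.
    eapply Rle_trans; [apply Rabs_triang|]. nra. }
  assert (Bc : Rabs (cos y) <= 1) by (apply Rabs_le; pose proof (COS_bound y); lra).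
  assert (T1 : Rabs (exp x * cos y + - (1) + - x) <= 3 * (e * m)).
  { replace (exp x * cos y + - (1) + - x) with
      ((exp x - 1 - 1 * x) * cos y + (1 + x) * (cos y - 1 - 0 * y)) by ring.
    eapply Rle_trans; [apply Rabs_triang|]. rewrite !Rabs_mult.
    assert (Rabs (1 + x) <= 2).
    { eapply Rle_trans; [apply Rabs_triang|]. rewrite Rabs_R1. lra. }
    pose proof (Rabs_pos (exp x - 1 - 1 * x)). pose proof (Rabs_pos (cos y - 1 - 0 * y)).
    pose proof (Rabs_pos (cos y)). pose proof (Rabs_pos (1 + x)).
    assert (Rabs (exp x - 1 - 1 * x) * Rabs (cos y) <= e * m * 1)
      by (apply Rmult_le_compat; assumption).
    assert (Rabs (1 + x) * Rabs (cos y - 1 - 0 * y) <= 2 * (e * m))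
      by (apply Rmult_le_compat; assumption).
    lra. }
  assert (T2 : Rabs (exp x * sin y + - 0 + - y) <= 5 * (e * m)).
  { replace (exp x * sin y + - 0 + - y) with
      ((exp x - 1) * sin y + (sin y - 0 - 1 * y)) by ring.
    eapply Rle_trans; [apply Rabs_triang|]. rewrite !Rabs_mult.
    assert (Rabs (exp x - 1) * Rabs (sin y) <= 2 * m * (2 * e))
      by (apply Rmult_le_compat; try apply Rabs_pos; assumption).
    lra. }
  nra.
Qed.

(** The functional equation transports the derivative from 0 to [z]. *)
Lemma cder_Cexp (z : C) : cder Cexp z (Cexp z).
Proof.
  intros eps Heps. pose proof (exp_pos (fst z)) as He.
  destruct (cder_Cexp_0 (eps / exp (fst z))) as [d [Hd H]]; [now apply Rdiv_lt_0_compat|].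
  exists d. split; [exact Hd|]. intros w Hw.
  specialize (H (w - z)%C). replace (w - z - 0)%C with (w - z)%C in H by ring.
  specialize (H Hw). rewrite Cexp_0 in H.
  replace (Cexp w - Cexp z - Cexp z * (w - z))%C with
    (Cexp z * (Cexp (w - z) - 1 - 1 * (w - z)))%C.
  - rewrite Cmod_mult, Cmod_Cexp.
    replace (eps * Cmod (w - z)) with (exp (fst z) * (eps / exp (fst z) * Cmod (w - z)))
      by (field; lra).
    apply Rmult_le_compat_l; [lra|exact H].
  - replace w with (z + (w - z))%C at 3 by ring. rewrite Cexp_plus. ring.
Qed.

(** The Cauchy-Riemann equations in the shape of [closed_form]: the imaginary part of [g dz] is
    [P dx + Q dy] with [P = Im g] and [Q = Re g], and the shared coefficient is [fst l]. *)
Lemma cder_differentiable (g : C -> C) (x y : R) (l : C) : cder g (x, y) l ->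
  differentiable_pt_lim (fun u v => snd (g (u, v))) x y (snd l) (fst l) /\
  differentiable_pt_lim (fun u v => fst (g (u, v))) x y (fst l) (- snd l).
Proof.
  intros H. split; intros eps;
  (* Both halves pay for the passage from the modulus to the maximum norm, which is at least half of
     it. *)
  destruct (H (eps / 2)) as [d [Hd Hw]]; try (pose proof (cond_pos eps); lra);
  exists (mkposreal (d / 2) ltac:(lra)); intros u v Hu Hv; simpl in Hu, Hv;
  set (k := (u - x, v - y) : C);
  assert (Hk : ((u, v) - (x, y))%C = k)
    by (unfold k, Cminus, Cplus, Copp; simpl; f_equal; ring);
  specialize (Hw (u, v)); rewrite Hk in Hw;
  pose proof (Cmod_le_abs k) as Hk2; unfold k in Hk2 at 2 3; simpl in Hk2;
  specialize (Hw ltac:(lra));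
  pose proof (Rmax_l (Rabs (u - x)) (Rabs (v - y)));
  pose proof (Rmax_r (Rabs (u - x)) (Rabs (v - y)));
  set (M := Rmax (Rabs (u - x)) (Rabs (v - y))) in *;
  (apply Rle_trans with (eps / 2 * Cmod k);
    [|pose proof (cond_pos eps); nra]);
  (eapply Rle_trans; [|exact Hw]).
  - eapply Rle_trans; [|apply abs_snd_le]. right. f_equal. unfold k. destruct l. simpl. ring.
  - eapply Rle_trans; [|apply abs_fst_le]. right. f_equal. unfold k. destruct l. simpl. ring.
Qed.

(** * Schwarz-Pick *)

Definition holo (f : C -> C) : Prop := forall z, in_disc z -> exists l, cder f z l.

(* [G(z)/z] in the logarithmic coordinate [z = exp s]: the circles [|z| = r] become
   vertical segments and the puncture [z = 0] goes to infinity. *)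
Definition log_quotient (G : C -> C) (s : C) : C := (G (Cexp s) * Cexp (- s))%C.

Lemma Cexp_in_disc (s : C) : fst s < 0 -> in_disc (Cexp s).
Proof.
  intros Hs. unfold in_disc. rewrite Cmod_Cexp, <- exp_0. now apply exp_increasing.
Qed.

Lemma Cexp_mult_opp (s : C) : (Cexp s * Cexp (- s))%C = 1.
Proof. rewrite <- Cexp_plus, <- Cexp_0. f_equal. ring. Qed.

Lemma log_quotient_cder (G : C -> C) (s : C) : holo G -> fst s < 0 ->
  exists l, cder (log_quotient G) s l.
Proof.
  intros HG Hs. destruct (HG (Cexp s) (Cexp_in_disc s Hs)) as [l Hl].
  eexists. unfold log_quotient. apply cder_mult.
  - apply (cder_comp G Cexp); [exact Hl|apply cder_Cexp].
  - apply (cder_comp Cexp (fun w => - w)%C); [apply cder_Cexp|].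
    intros eps Heps. destruct (cder_affine (- (1)) 0 s eps Heps) as [d [Hd H]].
    exists d. split; [exact Hd|]. intros w Hw. specialize (H w Hw).
    replace (- w - - s)%C with (- (1) * w + 0 - (- (1) * s + 0))%C by ring. exact H.
Qed.

Lemma log_quotient_periodic (G : C -> C) (x : R) :
  log_quotient G (x, 0) = log_quotient G (x, 0 + 2 * PI).
Proof.
  unfold log_quotient, Cexp. simpl. rewrite Ropp_0, Rplus_0_l, sin_neg, cos_neg.
  now rewrite sin_0, cos_0, sin_2PI, cos_2PI, Ropp_0.
Qed.

(** Goursat on the rectangle with sides [[a, b]] and [[0, 2 * PI]]: the horizontal edges cancel by
    periodicity, so the two vertical ones agree. *)
Lemma circle_mean_const (G : C -> C) (a b : R) : holo G -> a < b -> b < 0 ->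
  RInt (fun y => fst (log_quotient G (a, y))) 0 (0 + 2 * PI) =
  RInt (fun y => fst (log_quotient G (b, y))) 0 (0 + 2 * PI).
Proof.
  intros HG Hab Hb. pose proof PI_RGT_0 as Hpi.
  pose (P := fun x y => snd (log_quotient G (x, y))).
  pose (Q := fun x y => fst (log_quotient G (x, y))).
  assert (HPQ : forall x y, a <= x <= a + (b - a) -> 0 <= y <= 0 + 2 * PI ->
    exists p1 p2 q2, differentiable_pt_lim P x y p1 p2 /\ differentiable_pt_lim Q x y p2 q2).
  { intros x y Hx Hy. destruct (log_quotient_cder G (x, y) HG) as [l Hl]; [simpl; lra|].
    destruct (cder_differentiable _ _ _ _ Hl) as [H1 H2].
    exists (snd l), (fst l), (- snd l). now split. }
  pose proof (goursat P Q a 0 (b - a) (2 * PI) ltac:(lra) ltac:(lra) HPQ) as HJ.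
  rewrite (circulation_eq P Q a 0 (b - a) (2 * PI) HPQ) in HJ by lra.
  rewrite (RInt_ext (fun x => P x 0) (fun x => P x (0 + 2 * PI))) in HJ
    by (intros x _; unfold P; now rewrite log_quotient_periodic).
  replace (a + (b - a)) with b in HJ by ring. unfold Q in HJ. lra.
Qed.

Lemma ex_RInt_circle (G : C -> C) (a : R) : holo G -> a < 0 ->
  ex_RInt (fun y => fst (log_quotient G (a, y))) 0 (0 + 2 * PI).
Proof.
  intros HG Ha. apply (ex_RInt_continuous (V := R_CompleteNormedModule)).
  intros y _. destruct (log_quotient_cder G (a, y) HG Ha) as [l Hl].
  destruct (cder_differentiable _ _ _ _ Hl) as [_ H].
  exact (continuous_slice_y _ _ _ _ _ H).
Qed.

(** The mean of [Re (G(z)/z)] over a small circle is close to [fst l]; over a circle close to the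
    boundary it is at most [1 + eps / 2]. The two means are equal. *)
Lemma Re_derivative_le_1 (G : C -> C) (l : C) : holo G ->
  (forall z, in_disc z -> Cmod (G z) <= 1) -> G 0 = 0 -> cder G 0 l -> fst l <= 1.
Proof.
  intros HG HG1 HG0 Hl. pose proof PI_RGT_0 as Hpi.
  apply le_epsilon. intros eps Heps.
  destruct (Hl (eps / 2) ltac:(lra)) as [d [Hd Hder]].
  (* The outer radius is [exp b = 1 / (1 + eps / 2)]. *)
  set (b := - ln (1 + eps / 2)).
  assert (Hb : b < 0).
  { unfold b. pose proof (ln_increasing 1 (1 + eps / 2) ltac:(lra) ltac:(lra)) as H.
    rewrite ln_1 in H. lra. }
  (* The inner radius [exp a] lies below the outer one and inside the range [d] of the derivative
     estimate. *)
  set (a := Rmin (b - 1) (ln d - 1)).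
  assert (Hab : a < b) by (unfold a; pose proof (Rmin_l (b - 1) (ln d - 1)); lra).
  assert (Had : exp a < d).
  { rewrite <- (exp_ln d) by exact Hd. apply exp_increasing.
    unfold a. pose proof (Rmin_r (b - 1) (ln d - 1)). lra. }
  pose proof (circle_mean_const G a b HG Hab Hb) as E.
  assert (Ia : Rabs (RInt (fun y => fst (log_quotient G (a, y))) 0 (0 + 2 * PI)
                     - fst l * (2 * PI)) <= eps / 2 * (2 * PI)).
  { apply RInt_near_const; [lra|apply ex_RInt_circle; [exact HG|lra]|].
    intros y _.
    assert (Hz : Cmod (Cexp (a, y) - 0) < d).
    { replace (Cexp (a, y) - 0)%C with (Cexp (a, y)) by ring. now rewrite Cmod_Cexp. }
    specialize (Hder _ Hz). rewrite HG0 in Hder.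
    replace (fst (log_quotient G (a, y)) - fst l) with (fst (log_quotient G (a, y) - l)%C)
      by (simpl; ring).
    eapply Rle_trans; [apply abs_fst_le|]. unfold log_quotient.
    replace (G (Cexp (a, y)) * Cexp (- (a, y)) - l)%C with
      ((G (Cexp (a, y)) - 0 - l * (Cexp (a, y) - 0)) * Cexp (- (a, y)))%C.
    - rewrite Cmod_mult.
      replace (eps / 2) with
        (eps / 2 * Cmod (Cexp (a, y) - 0) * Cmod (Cexp (- (a, y)))).
      + apply Rmult_le_compat_r; [apply Cmod_ge_0|exact Hder].
      + rewrite Rmult_assoc, <- Cmod_mult.
        replace ((Cexp (a, y) - 0) * Cexp (- (a, y)))%C with (RtoC 1)
          by (rewrite <- (Cexp_mult_opp (a, y)); ring).
        rewrite Cmod_1. ring.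
    - replace l with (l * 1)%C at 2 by ring. rewrite <- (Cexp_mult_opp (a, y)). ring. }
  assert (Ib : Rabs (RInt (fun y => fst (log_quotient G (b, y))) 0 (0 + 2 * PI)
                     - 0 * (2 * PI)) <= (1 + eps / 2) * (2 * PI)).
  { apply RInt_near_const; [lra|apply ex_RInt_circle; [exact HG|lra]|].
    intros y _. rewrite Rminus_0_r. eapply Rle_trans; [apply abs_fst_le|].
    unfold log_quotient. rewrite Cmod_mult, Cmod_Cexp. simpl.
    unfold b at 2. rewrite Ropp_involutive, exp_ln by lra.
    pose proof (HG1 (Cexp (b, y)) (Cexp_in_disc (b, y) Hb)). nra. }
  rewrite <- E in Ib. apply Rabs_le_between in Ia. apply Rabs_le_between in Ib. nra.
Qed.

Lemma unimodular_rotation (l : C) : exists u : C, Cmod u = 1 /\ (u * l)%C = RtoC (Cmod l).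
Proof.
  destruct (classic (l = 0)) as [->|Hl].
  - exists (RtoC 1). rewrite Cmod_1, Cmod_0. split; [reflexivity|ring].
  - pose proof (proj1 (Cmod_gt_0 l) Hl) as Hp.
    assert (Hn : RtoC (Cmod l) <> 0) by (intros E; apply RtoC_inj in E; lra).
    exists (Cconj l / Cmod l)%C. split.
    + rewrite Cmod_div by exact Hn. rewrite Cmod_conj, Cmod_R, Rabs_pos_eq by lra.
      field. lra.
    + replace (Cconj l / Cmod l * l)%C with (l * Cconj l / Cmod l)%C by (field; exact Hn).
      rewrite <- Cmod2_conj, <- RtoC_div by lra. f_equal. field. lra.
Qed.

(** A rotation of [G] makes its derivative at 0 equal to [Cmod l]. *)
Lemma derivative_0_le_1 (G : C -> C) (l : C) : holo G ->
  (forall z, in_disc z -> Cmod (G z) <= 1) -> G 0 = 0 -> cder G 0 l -> Cmod l <= 1.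
Proof.
  intros HG HG1 HG0 Hl. destruct (unimodular_rotation l) as [u [Hu Hul]].
  assert (Hd : forall z m, cder G z m -> cder (fun w => u * G w)%C z (u * m)%C).
  { intros z m Hm eps Heps. destruct (Hm eps Heps) as [d [Hd H]].
    exists d. split; [exact Hd|]. intros w Hw. specialize (H w Hw).
    replace (u * G w - u * G z - u * m * (w - z))%C with
      (u * (G w - G z - m * (w - z)))%C by ring.
    rewrite Cmod_mult, Hu, Rmult_1_l. exact H. }
  assert (H : fst (u * l)%C <= 1).
  { apply (Re_derivative_le_1 (fun w => u * G w)%C).
    - intros z Hz. destruct (HG z Hz) as [m Hm]. exists (u * m)%C. now apply Hd.
    - intros z Hz. rewrite Cmod_mult, Hu, Rmult_1_l. now apply HG1.
    - rewrite HG0. ring.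
    - now apply Hd. }
  rewrite Hul in H. exact H.
Qed.

(** * Self-maps of the disc and Moebius invariance *)

Definition self_map (F : C -> C) : Prop := holo F /\ forall z, in_disc z -> in_disc (F z).

Lemma self_map_comp (F G : C -> C) : self_map F -> self_map G -> self_map (fun z => F (G z)).
Proof.
  intros [HF HF1] [HG HG1]. split; [|auto].
  intros z Hz. destruct (HG z Hz) as [m Hm]. destruct (HF _ (HG1 z Hz)) as [l Hl].
  exists (l * m)%C. now apply (cder_comp F G).
Qed.

Lemma self_map_mob (a : C) : in_disc a -> self_map (mob a).
Proof.
  intros Ha. split.
  - intros z Hz. eexists. now apply cder_mob.
  - intros z Hz. now apply mob_in_disc.
Qed.

(** Moving [b] and [F b] to 0 by Moebius maps gives a self-map that fixes 0, with derivative
    [l * (1 - |b|^2) / (1 - |F b|^2)] there. *)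
Lemma infinitesimal_schwarz_pick (F : C -> C) (b l : C) : self_map F -> in_disc b ->
  cder F b l -> Cmod l * (1 - Cmod b * Cmod b) <= 1 - Cmod (F b) * Cmod (F b).
Proof.
  intros HF Hb Hl. pose proof (proj2 HF b Hb) as Ha. set (a := F b) in *.
  assert (HG : self_map (fun z => mob a (F (mob (- b) z)))).
  { apply (self_map_comp (mob a)); [now apply self_map_mob|].
    apply (self_map_comp F); [exact HF|]. apply self_map_mob. now apply in_disc_opp. }
  assert (Hn : forall c, Cmod (1 - Cconj c * c) = Rabs (1 - Cmod c * Cmod c)).
  { intros c. rewrite Cmult_comm, <- Cmod2_conj, <- RtoC_minus, Cmod_R.
    f_equal. ring. }
  assert (Ha1 : 0 < 1 - Cmod a * Cmod a)
    by (unfold in_disc in Ha; pose proof (Cmod_ge_0 a); nra).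
  assert (Hb1 : 0 < 1 - Cmod b * Cmod b)
    by (unfold in_disc in Hb; pose proof (Cmod_ge_0 b); nra).
  assert (Ha0 : (1 - Cconj a * a)%C <> 0) by now apply one_minus_sq_neq0.
  pose proof (cder_mob (- b) 0 (in_disc_opp b Hb) in_disc_0) as H1.
  assert (H2 : cder F (mob (- b) 0) l) by now rewrite mob_opp_0.
  assert (H3 := cder_mob a (F (mob (- b) 0)) Ha ltac:(rewrite mob_opp_0; exact Ha)).
  pose proof (cder_comp _ _ _ _ _ H3 (cder_comp _ _ _ _ _ H2 H1)) as H4.
  pose proof (derivative_0_le_1 _ _ (proj1 HG)
    (fun z Hz => Rlt_le _ _ (proj2 HG z Hz))
    ltac:(simpl; rewrite mob_opp_0; apply mob_self) H4) as H5.
  rewrite mob_opp_0 in H5. fold a in H5. rewrite Copp_conj in H5.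
  match type of H5 with Cmod ?t <= _ =>
    replace t with (l * (1 - Cconj b * b) / (1 - Cconj a * a))%C in H5 end.
  - rewrite Cmod_div, Cmod_mult, !Hn, !Rabs_pos_eq in H5 by (lra || exact Ha0).
    apply Rle_div_l in H5; lra.
  - field. exact Ha0.
Qed.

Lemma nonincreasing_of_derivative (q : R -> R) (a b : R) : a <= b ->
  (forall t, a <= t <= b -> exists d, d <= 0 /\ is_derive q t d) -> q b <= q a.
Proof.
  intros Hab H.
  destruct (MVT_gen q a b (Derive q)) as [c [Hc E]].
  - intros t Ht. rewrite Rmin_left, Rmax_right in Ht by lra.
    destruct (H t ltac:(lra)) as [d [_ Hd]]. apply Derive_correct. now exists d.
  - intros t Ht. rewrite Rmin_left, Rmax_right in Ht by lra.
    destruct (H t ltac:(lra)) as [d [_ Hd]]. apply continuity_pt_filterlim.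
    apply (ex_derive_continuous (V := R_NormedModule)). now exists d.
  - rewrite Rmin_left, Rmax_right in Hc by lra.
    destruct (H c Hc) as [d [Hd0 Hd]]. apply is_derive_unique in Hd. rewrite Hd in E.
    nra.
Qed.

Lemma is_derive_hyp (x : R) : -1 < x < 1 -> is_derive hyp x (2 / (1 - x * x)).
Proof.
  intros Hx. unfold hyp. auto_derive.
  - repeat split; try lra. apply hyp_arg_pos; lra.
  - field. repeat split; nra.
Qed.

Lemma is_derive_along_ray (F : C -> C) (e u l : C) (t : R) : Cmod e = 1 -> Cmod u = 1 ->
  cder F (RtoC t * e)%C l ->
  is_derive (fun s : R => fst (u * F (RtoC s * e))%C) t (fst (u * l * e)%C).
Proof.
  intros He Hu Hl. apply is_derive_Reals. intros eps Heps.
  destruct (Hl (eps / 2) ltac:(lra)) as [d [Hd H]].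
  exists (mkposreal d Hd). intros h Hh Hhd. simpl in Hhd.
  assert (E : (RtoC (t + h) * e - RtoC t * e)%C = (RtoC h * e)%C)
    by (rewrite RtoC_plus; ring).
  specialize (H (RtoC (t + h) * e)%C). rewrite E in H.
  rewrite !Cmod_mult, Cmod_R, He, Rmult_1_r in H. specialize (H Hhd).
  set (A := (F (RtoC (t + h) * e) - F (RtoC t * e) - l * (RtoC h * e))%C) in *.
  replace ((fst (u * F (RtoC (t + h) * e))%C - fst (u * F (RtoC t * e))%C) / h
           - fst (u * l * e)%C) with (fst (u * A)%C / h)
    by (unfold A; simpl; field; exact Hh).
  unfold Rdiv. rewrite Rabs_mult, Rabs_inv.
  pose proof (Rabs_pos_lt h Hh) as Hp.
  change (Rabs (fst (u * A)%C) / Rabs h < eps).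
  apply Rlt_div_l; [exact Hp|].
  pose proof (abs_fst_le (u * A)) as Hf. rewrite Cmod_mult, Hu, Rmult_1_l in Hf. nra.
Qed.

(* Along the ray through [u], [p t = Re (v G(t e))] satisfies
   [p' / (1 - p^2) <= 1 / (1 - t^2)], so [hyp (p t) - hyp t] does not increase. *)
Lemma schwarz (G : C -> C) (z : C) : self_map G -> G 0 = 0 -> in_disc z ->
  Cmod (G z) <= Cmod z.
Proof.
  intros HG HG0 Hz. destruct (classic (z = 0)) as [->|Hz0].
  { rewrite HG0. lra. }
  pose proof (proj1 (Cmod_gt_0 z) Hz0) as Hr. set (r := Cmod z) in *.
  assert (Hrn : RtoC r <> 0) by (intros E; apply RtoC_inj in E; lra).
  set (e := (z / r)%C).
  assert (He : Cmod e = 1).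
  { unfold e. rewrite Cmod_div by exact Hrn. rewrite Cmod_R, Rabs_pos_eq by lra.
    unfold r in *. field. lra. }
  assert (Hze : z = (RtoC r * e)%C) by (unfold e; field; exact Hrn).
  (* This rotation makes [p r] equal to [Cmod (G z)], while [p] stays below the modulus all along
     the ray. *)
  destruct (unimodular_rotation (G z)) as [v [Hv Hvz]].
  set (p := fun t : R => fst (v * G (RtoC t * e))%C).
  assert (Hin : forall t : R, 0 <= t <= r -> Cmod (RtoC t * e) = t).
  { intros t Ht. rewrite Cmod_mult, He, Cmod_R, Rabs_pos_eq; lra. }
  assert (Hp : forall t : R, Rabs (p t) <= Cmod (G (RtoC t * e)%C)).
  { intros t. eapply Rle_trans; [apply abs_fst_le|]. rewrite Cmod_mult, Hv. lra. }
  unfold in_disc in Hz. fold r in Hz.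
  assert (Hq : hyp (p r) - hyp r <= hyp (p 0) - hyp 0).
  { apply (nonincreasing_of_derivative (fun t => hyp (p t) - hyp t)); [lra|].
    intros t Ht.
    assert (Htd : in_disc (RtoC t * e)%C) by (unfold in_disc; rewrite Hin; lra).
    destruct (proj1 HG _ Htd) as [l Hl].
    pose proof (infinitesimal_schwarz_pick G _ l HG Htd Hl) as Hsp.
    pose proof (proj2 HG _ Htd) as Hg. unfold in_disc in Hg.
    rewrite Hin in Hsp by lra. pose proof (Hp t) as Hpt.
    set (g := Cmod (G (RtoC t * e)%C)) in *.
    assert (Hpt' : -1 < p t < 1) by (apply Rabs_le_between in Hpt; lra).
    pose proof (is_derive_along_ray G e v l t He Hv Hl) as Hdp.
    set (dp := fst (v * l * e)%C) in *.
    assert (Hdl : dp <= Cmod l).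
    { eapply Rle_trans; [apply Rle_abs|]. eapply Rle_trans; [apply abs_fst_le|].
      rewrite !Cmod_mult, Hv, He. lra. }
    (* The sign comes from [dp * (1 - t^2) <= |l| * (1 - t^2) <= 1 - g^2 <= 1 - (p t)^2], where the
       middle inequality is infinitesimal Schwarz-Pick. *)
    exists (dp * (2 / (1 - p t * p t)) - 2 / (1 - t * t)). split.
    - assert (Hpg : p t * p t <= g * g).
      { apply Rabs_le_between in Hpt. nra. }
      assert (0 < 1 - t * t) by nra. assert (0 < 1 - p t * p t) by nra.
      assert (dp * (1 - t * t) <= 1 - p t * p t) by nra.
      replace (dp * (2 / (1 - p t * p t)) - 2 / (1 - t * t)) with
        (2 * (dp * (1 - t * t) - (1 - p t * p t)) / ((1 - p t * p t) * (1 - t * t)))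
        by (field; lra).
      apply Rle_div_l; [nra|]. lra.
    - apply (is_derive_minus (V := R_NormedModule) (fun s => hyp (p s)) hyp).
      + apply (is_derive_comp hyp p); [now apply is_derive_hyp|exact Hdp].
      + apply is_derive_hyp. lra. }
  assert (Hp0 : p 0 = 0).
  { unfold p. replace (RtoC 0 * e)%C with (RtoC 0) by ring. rewrite HG0. simpl. ring. }
  assert (Hpr : p r = Cmod (G z)).
  { unfold p. rewrite <- Hze, Hvz. reflexivity. }
  pose proof (proj2 HG z Hz) as Hgz. unfold in_disc in Hgz.
  rewrite Hp0, Hpr in Hq. apply hyp_inv_le; lra.
Qed.

(** Schwarz's lemma at [mob w z] for the conjugated map, which fixes 0. *)
Lemma self_map_schwarz_pick (F : C -> C) (z w : C) : self_map F -> in_disc z -> in_disc w ->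
  rho (F z) (F w) <= rho z w.
Proof.
  intros HF Hz Hw. pose proof (proj2 HF w Hw) as Ha.
  assert (HG : self_map (fun u => mob (F w) (F (mob (- w) u)))).
  { apply (self_map_comp (mob (F w))); [now apply self_map_mob|].
    apply (self_map_comp F); [exact HF|]. apply self_map_mob. now apply in_disc_opp. }
  rewrite !rho_mob.
  pose proof (schwarz _ (mob w z) HG) as H. cbv beta in H.
  rewrite mob_opp_0, mob_self, mob_opp_mob in H by assumption.
  apply H; [reflexivity|now apply mob_in_disc].
Qed.

(** The class [in_U] expressed through [cder]. Modulus 1 is allowed, as for unimodular constants. *)
Definition weak_self_map (f : C -> C) : Prop :=
  holo f /\ forall z, in_disc z -> Cmod (f z) <= 1.

Lemma holo_scale (f : C -> C) (c : C) : holo f -> holo (fun z => c * f z)%C.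
Proof.
  intros Hf z Hz. destruct (Hf z Hz) as [l Hl]. exists (c * l)%C.
  intros eps Heps.
  destruct (cder_comp (fun w => c * w + 0)%C f z c l (cder_affine _ _ _) Hl eps Heps)
    as [d [Hd H]].
  exists d. split; [exact Hd|]. intros w Hw. specialize (H w Hw).
  replace (c * f w + 0 - (c * f z + 0))%C with (c * f w - c * f z)%C in H by ring. exact H.
Qed.

(* Multiplied out, the inequality survives at points where [|f| = 1]. *)
Lemma schwarz_pick (f : C -> C) (z w : C) : weak_self_map f -> in_disc z -> in_disc w ->
  Cmod (f z - f w) <= rho z w * Cmod (1 - Cconj (f w) * f z).
Proof.
  intros [Hf Hf1] Hz Hw.
  pose proof (Hf1 z Hz) as Hz1. pose proof (Hf1 w Hw) as Hw1.
  pose proof (rho_ge0 z w) as Hr0. pose proof (rho_lt1 z w Hz Hw) as Hr1.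
  pose proof (Cmod_ge_0 (f z)) as Hz0. pose proof (Cmod_ge_0 (f w)) as Hw0.
  set (A := Cmod (f z - f w)). set (B := Cmod (1 - Cconj (f w) * f z)).
  assert (HA : 0 <= A) by apply Cmod_ge_0. assert (HB : 0 <= B) by apply Cmod_ge_0.
  (* [t * f] maps into the open disc, where the strict version applies; afterwards [t] tends to
     1. *)
  assert (H : forall t, 0 < t < 1 -> t * A <= rho z w * (B + (1 - t * t))).
  { intros t Ht.
    assert (HF : self_map (fun u => RtoC t * f u)%C).
    { split; [now apply holo_scale|]. intros u Hu. unfold in_disc.
      rewrite Cmod_mult, Cmod_R, Rabs_pos_eq by lra. pose proof (Hf1 u Hu). nra. }
    pose proof (self_map_schwarz_pick _ z w HF Hz Hw) as H.
    pose proof (proj2 HF z Hz) as H1. pose proof (proj2 HF w Hw) as H2.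
    unfold in_disc in H1, H2. cbv beta in H1, H2.
    unfold rho at 1 in H.
    rewrite Cmod_div in H by (apply den_neq0; lra).
    apply Rle_div_l in H; [|apply den_pos; lra].
    rewrite (Cmod_minus_sym (RtoC t * f w)) in H.
    replace (RtoC t * f z - RtoC t * f w)%C with (RtoC t * (f z - f w))%C in H by ring.
    rewrite Cmod_mult, Cmod_R, Rabs_pos_eq in H by lra. fold A in H.
    eapply Rle_trans; [exact H|]. apply Rmult_le_compat_l; [exact Hr0|].
    rewrite Cmult_conj.
    replace (Cconj (RtoC t)) with (RtoC t)
      by (unfold Cconj, RtoC; simpl; f_equal; ring).
    replace (1 - RtoC t * Cconj (f w) * (RtoC t * f z))%C with
      ((1 - Cconj (f w) * f z) + RtoC (1 - t * t) * (Cconj (f w) * f z))%C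
      by (rewrite RtoC_minus, RtoC_mult; ring).
    eapply Rle_trans; [apply Cmod_triangle|]. fold B. apply Rplus_le_compat_l.
    assert (Ht2 : 0 <= 1 - t * t) by nra.
    rewrite !Cmod_mult, Cmod_R, Cmod_conj, Rabs_pos_eq by exact Ht2.
    assert (Cmod (f w) * Cmod (f z) <= 1) by nra. nra. }
  apply le_epsilon. intros eps Heps.
  (* With [t = 1 - s] the total error is at most [s * A + 2 * s]. *)
  set (s := Rmin (1 / 2) (eps / (A + 2))).
  assert (Hs : 0 < s) by (apply Rmin_pos; [lra|apply Rdiv_lt_0_compat; lra]).
  assert (Hs1 : s <= 1 / 2) by apply Rmin_l.
  assert (Hs2 : s <= eps / (A + 2)) by apply Rmin_r.
  apply Rle_div_r in Hs2; [|lra].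
  specialize (H (1 - s) ltac:(lra)).
  assert (rho z w * (B + (1 - (1 - s) * (1 - s))) <= rho z w * B + 2 * s) by nra.
  nra.
Qed.

(** * Dense sequences are sampling *)

Lemma in_U_weak_self_map (f : C -> C) : in_U f <-> weak_self_map f.
Proof.
  split; intros [H1 H2]; (split; [|exact H2]); intros z Hz; destruct (H1 z Hz) as [l Hl];
    exists l; now apply is_derive_cder.
Qed.

(** If [|f w| = 1], both sides of Schwarz-Pick contain the factor [|f z - f w|], and [rho z w < 1]
    forces it to vanish. *)
Lemma unimodular_constant (f : C -> C) (z w : C) : weak_self_map f ->
  in_disc z -> in_disc w -> Cmod (f w) = 1 -> f z = f w.
Proof.
  intros Hf Hz Hw H1. pose proof (schwarz_pick f z w Hf Hz Hw) as H.
  pose proof (rho_lt1 z w Hz Hw) as Hr. pose proof (rho_ge0 z w) as Hr0.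
  assert (E : (f w * Cconj (f w))%C = 1) by (rewrite <- Cmod2_conj, H1; f_equal; ring).
  replace (1 - Cconj (f w) * f z)%C with (Cconj (f w) * (f w - f z))%C in H
    by (rewrite <- E; ring).
  rewrite Cmod_mult, Cmod_conj, H1, (Cmod_minus_sym (f w)) in H.
  pose proof (Cmod_ge_0 (f z - f w)).
  assert (E0 : Cmod (f z - f w) = 0) by nra. apply Cmod_eq_0 in E0.
  replace (f z) with (f z - f w + f w)%C by ring. rewrite E0. ring.
Qed.

Lemma self_map_or_constant (f : C -> C) : weak_self_map f ->
  self_map f \/ forall z w, in_disc z -> in_disc w -> f z = f w.
Proof.
  intros Hf. destruct (classic (exists u, in_disc u /\ Cmod (f u) = 1)) as [[u [Hu H1]]|Hno].
  - right. intros z w Hz Hw. rewrite (unimodular_constant f z u) by assumption.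
    symmetry. now apply unimodular_constant.
  - left. split; [apply Hf|]. intros z Hz. unfold in_disc.
    destruct (proj2 Hf z Hz) as [H|H]; [exact H|]. exfalso. apply Hno. now exists z.
Qed.

Lemma beta_contraction (f : C -> C) (z w : C) : weak_self_map f -> in_disc z -> in_disc w ->
  0 <= beta (f z) (f w) <= beta z w.
Proof.
  intros Hf Hz Hw. destruct (self_map_or_constant f Hf) as [Hs|Hc].
  - split; [apply beta_ge0; now apply (proj2 Hs)|]. rewrite !beta_hyp.
    pose proof (rho_ge0 (f z) (f w)). pose proof (rho_lt1 z w Hz Hw).
    apply hyp_le; [lra|now apply self_map_schwarz_pick|lra].
  - rewrite (Hc z w Hz Hw), beta_self. split; [lra|now apply beta_ge0].
Qed.

(** Presents [N f] as a real number, the least hyperbolic Lipschitz constant of [f]; it is at most 1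
    by Schwarz-Pick. *)
Lemma N_finite (f : C -> C) : weak_self_map f -> exists L, Defs.N f = Finite L /\ 0 <= L <= 1 /\
  (forall z w, in_disc z -> in_disc w -> beta (f z) (f w) <= L * beta z w) /\
  (forall M, (forall z w, in_disc z -> in_disc w -> beta (f z) (f w) <= M * beta z w) -> L <= M).
Proof.
  intros Hf. unfold Defs.N.
  set (E := fun r => exists z w : C,
    in_disc z /\ in_disc w /\ z <> w /\ r = beta (f z) (f w) / beta z w).
  pose proof (Lub_Rbar_correct E) as [Hub Hlub].
  assert (HM : forall M, (forall z w, in_disc z -> in_disc w ->
    beta (f z) (f w) <= M * beta z w) -> Rbar_le (Lub_Rbar E) (Finite M)).
  { intros M H. apply Hlub. intros r [z [w [Hz [Hw [Hne ->]]]]]. simpl.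
    pose proof (beta_pos z w Hz Hw Hne). apply Rle_div_l; [assumption|now apply H]. }
  pose proof (HM 1 ltac:(intros z w Hz Hw; pose proof (beta_contraction f z w Hf Hz Hw); lra))
    as H1.
  (* One pair of distinct points shows that the set of ratios is inhabited, so its supremum is not
     minus infinity. *)
  assert (Hh : in_disc (RtoC (1 / 2))).
  { unfold in_disc. rewrite Cmod_R, Rabs_pos_eq; lra. }
  assert (Hh0 : RtoC (1 / 2) <> 0) by (intros Eq; apply RtoC_inj in Eq; lra).
  assert (H0 : Rbar_le (Finite 0) (Lub_Rbar E)).
  { apply Rbar_le_trans with (Finite (beta (f (RtoC (1 / 2))) (f 0) / beta (RtoC (1 / 2)) 0)).
    - simpl. pose proof (beta_contraction f _ _ Hf Hh in_disc_0) as [Hb _].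
      pose proof (beta_pos _ _ Hh in_disc_0 Hh0). apply Rle_div_r; [assumption|lra].
    - apply Hub. exists (RtoC (1 / 2)), (RtoC 0).
      repeat split; [exact Hh|exact in_disc_0|exact Hh0]. }
  destruct (Lub_Rbar E) as [L| |]; try contradiction.
  exists L. split; [reflexivity|]. split; [now split|]. split.
  - intros z w Hz Hw. destruct (classic (z = w)) as [->|Hne].
    + rewrite !beta_self. lra.
    + assert (Hr : Rbar_le (Finite (beta (f z) (f w) / beta z w)) (Finite L)).
      { apply Hub. now exists z, w. }
      simpl in Hr. apply Rle_div_l in Hr; [exact Hr|now apply beta_pos].
  - exact HM.
Qed.

(** * Decay of a function that is small along a dense sequence *)

Lemma mob_mob_opp (a z : C) : in_disc a -> in_disc z -> mob a (mob (- a) z) = z.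
Proof.
  intros Ha Hz. replace a with (- - a)%C at 1 by ring.
  apply mob_opp_mob; [now apply in_disc_opp|exact Hz].
Qed.

(** Schwarz-Pick for [f / m] on the pseudo-hyperbolic disc of radius [tau] about [z], rescaled to
    the unit disc; [w] then sits at modulus [rho w z / tau]. *)
Lemma local_schwarz_pick (f : C -> C) (z w : C) (m tau : R) : holo f -> 0 < m ->
  0 < tau < 1 -> in_disc z -> in_disc w ->
  (forall v, in_disc v -> rho v z < tau -> Cmod (f v) <= m) -> rho w z < tau ->
  Cmod (f z - f w) <= rho w z / tau * (m + Cmod (f w)).
Proof.
  intros Hf Hm Htau Hz Hw Hb Hwz.
  (* The [+ 0] gives the inner map the form of [cder_affine]. *)
  set (phi := fun u : C => mob (- z) (RtoC tau * u + 0)).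
  assert (Hsc : forall u, in_disc u -> in_disc (RtoC tau * u + 0)%C /\
    Cmod (RtoC tau * u + 0) < tau).
  { intros u Hu. unfold in_disc in *.
    replace (RtoC tau * u + 0)%C with (RtoC tau * u)%C by ring.
    rewrite Cmod_mult, Cmod_R, Rabs_pos_eq by lra. nra. }
  set (F := fun u => (RtoC (/ m) * f (phi u))%C).
  assert (HF : weak_self_map F).
  { split.
    - apply holo_scale. intros u Hu. destruct (Hsc u Hu) as [Hu1 _].
      destruct (Hf (phi u)) as [l Hl].
      { apply mob_in_disc; [now apply in_disc_opp|exact Hu1]. }
      eexists. apply (cder_comp f phi); [exact Hl|].
      apply (cder_comp (mob (- z)) (fun v => RtoC tau * v + 0)%C).
      + apply cder_mob; [now apply in_disc_opp|exact Hu1].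
      + apply cder_affine.
    - intros u Hu. destruct (Hsc u Hu) as [Hu1 Hu2]. unfold F.
      assert (Hmi : 0 < / m) by now apply Rinv_0_lt_compat.
      rewrite Cmod_mult, Cmod_R, Rabs_pos_eq by lra.
      assert (Hp : Cmod (f (phi u)) <= m).
      { apply Hb; [apply mob_in_disc; [now apply in_disc_opp|exact Hu1]|].
        unfold phi. rewrite rho_mob, mob_mob_opp by assumption. exact Hu2. }
      rewrite Rmult_comm. apply Rle_div_l; lra. }
  assert (Htn : RtoC tau <> 0) by (intros E; apply RtoC_inj in E; lra).
  assert (Hcu : Cmod (mob z w / RtoC tau) = rho w z / tau).
  { rewrite Cmod_div, Cmod_R, Rabs_pos_eq by (lra || exact Htn). now rewrite rho_mob. }
  assert (Hu : in_disc (mob z w / RtoC tau)%C).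
  { unfold in_disc. rewrite Hcu. apply Rlt_div_l; lra. }
  pose proof (schwarz_pick F 0 _ HF in_disc_0 Hu) as H.
  pose proof (Cmod_one_minus_le (F (mob z w / RtoC tau)%C) (F 0)) as H1.
  pose proof (proj2 HF 0 in_disc_0) as HF0.
  rewrite (rho_sym 0 _ in_disc_0 Hu), rho_0_r, Hcu in H.
  assert (E0 : F 0 = (RtoC (/ m) * f z)%C).
  { unfold F, phi. do 2 f_equal. replace (RtoC tau * 0 + 0)%C with (RtoC 0) by ring.
    apply mob_opp_0. }
  assert (Ew : F (mob z w / RtoC tau)%C = (RtoC (/ m) * f w)%C).
  { unfold F, phi. do 2 f_equal.
    replace (RtoC tau * (mob z w / RtoC tau) + 0)%C with (mob z w) by (field; exact Htn).
    now apply mob_opp_mob. }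
  pose proof (rho_ge0 w z) as Hr0.
  assert (Hq : 0 <= rho w z / tau) by (apply Rle_div_r; lra).
  assert (H2 : Cmod (F 0 - F (mob z w / RtoC tau))%C <=
    rho w z / tau * (1 + Cmod (F (mob z w / RtoC tau)%C))).
  { eapply Rle_trans; [exact H|]. apply Rmult_le_compat_l; [exact Hq|].
    eapply Rle_trans; [exact H1|]. pose proof (Cmod_ge_0 (F (mob z w / RtoC tau)%C)). nra. }
  assert (Hmi : 0 < / m) by now apply Rinv_0_lt_compat.
  rewrite E0, Ew in H2.
  replace (RtoC (/ m) * f z - RtoC (/ m) * f w)%C with (RtoC (/ m) * (f z - f w))%C in H2
    by ring.
  rewrite !Cmod_mult, Cmod_R, Rabs_pos_eq in H2 by lra.
  apply (Rmult_le_compat_l m) in H2; [|lra].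
  replace (m * (/ m * Cmod (f z - f w))) with (Cmod (f z - f w)) in H2 by (field; lra).
  replace (m * (rho w z / tau * (1 + / m * Cmod (f w)))) with
    (rho w z / tau * (m + Cmod (f w))) in H2 by (field; lra).
  exact H2.
Qed.

Lemma rho_lt_hyp_inv (z w : C) (r : R) : in_disc z -> in_disc w -> 0 < r ->
  (rho z w < hyp_inv r <-> beta z w < r).
Proof.
  intros Hz Hw Hr. pose proof (hyp_inv_range r Hr). pose proof (rho_ge0 z w).
  pose proof (rho_lt1 z w Hz Hw). rewrite beta_hyp. split; intros H2.
  - rewrite <- (hyp_hyp_inv r). apply hyp_lt; lra.
  - apply hyp_inv_lt; try lra. now rewrite hyp_hyp_inv.
Qed.

(** One application of [local_schwarz_pick] on a disc of radius [t] improves a bound [m] to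
    [th * m + 2 * d], with [th = hyp_inv R1 / hyp_inv t]. The additive term is the fixed point of
    this map, and each application costs [t] in radius. *)
Lemma decay (f : C -> C) (z0 : C) (R1 t T M d : R) : holo f -> in_disc z0 ->
  0 < R1 < t -> 0 < M -> 0 <= d ->
  (forall z, in_disc z -> beta z z0 < T -> Cmod (f z) <= M /\
     exists w, in_disc w /\ beta w z < R1 /\ Cmod (f w) <= d) ->
  forall k z, in_disc z -> beta z z0 < T - INR k * t ->
    Cmod (f z) <= (hyp_inv R1 / hyp_inv t) ^ k * M
                  + 2 * d / (1 - hyp_inv R1 / hyp_inv t).
Proof.
  intros Hf Hz0 HR1 HM Hd H.
  pose proof (hyp_inv_range t ltac:(lra)) as Ht. pose proof (hyp_inv_range R1 ltac:(lra)) as H1.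
  pose proof (hyp_inv_increasing R1 t ltac:(lra)) as H1t.
  set (tau := hyp_inv t) in *. set (th := hyp_inv R1 / tau).
  assert (Hth : 0 < th < 1).
  { split; [apply Rdiv_lt_0_compat; lra|]. apply Rlt_div_l; lra. }
  assert (Hd' : 0 <= 2 * d / (1 - th)) by (apply Rle_div_r; lra).
  induction k as [|k IH]; intros z Hz Hb.
  - simpl in *. destruct (H z Hz ltac:(lra)) as [H2 _]. lra.
  - rewrite S_INR in Hb. pose proof (pos_INR k) as Hk.
    destruct (H z Hz ltac:(nra)) as [_ [w [Hw [Hwz Hfw]]]].
    pose proof (pow_lt th k (proj1 Hth)) as Hpk.
    set (m := th ^ k * M + 2 * d / (1 - th)) in *.
    assert (Hm : 0 < m) by (unfold m; nra).
    assert (Hball : forall v, in_disc v -> rho v z < tau -> Cmod (f v) <= m).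
    { intros v Hv Hvz. apply IH; [exact Hv|].
      apply (rho_lt_hyp_inv v z t) in Hvz; try assumption; try lra.
      pose proof (beta_triangle v z z0 Hv Hz Hz0). lra. }
    apply (rho_lt_hyp_inv w z R1) in Hwz; try assumption; try lra.
    pose proof (local_schwarz_pick f z w m tau Hf Hm Ht Hz Hw Hball ltac:(lra)) as Hs.
    assert (Hq : rho w z / tau <= th).
    { unfold th, Rdiv. apply Rmult_le_compat_r; [left; apply Rinv_0_lt_compat|]; lra. }
    pose proof (Cmod_triangle_rev (f z) (f w)) as Ht1. pose proof (Cmod_ge_0 (f w)).
    assert (Hs2 : rho w z / tau * (m + Cmod (f w)) <= th * (m + d)).
    { apply Rmult_le_compat; try lra. apply Rle_div_r; [lra|].
      pose proof (rho_ge0 w z). lra. }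
    assert (Hfix : th * (2 * d / (1 - th)) + 2 * d = 2 * d / (1 - th)) by (field; lra).
    assert (Hstep : th * m + 2 * d = th ^ S k * M + 2 * d / (1 - th)).
    { unfold m. rewrite <- Hfix at 2. simpl. ring. }
    rewrite <- Hstep. nra.
Qed.

(** [T] is such that [k] steps of [decay] leave a disc of radius [8 * R1]. The two smallness
    conditions bound each term of [decay] by [L * tau / 64] there. One more local Schwarz-Pick gives
    [rho (f z0) (f w0) <= L * rho w0 z0 / 8], and the 4 of [hyp_le_4] leaves [L / 2]. *)
Lemma near_pair_contraction (f : C -> C) (Z : nat -> C) (n0 k : nat) (z0 w0 : C)
    (R1 L eta : R) :
  self_map f -> (forall n, in_disc (Z n)) -> in_disc z0 -> in_disc w0 ->
  0 < R1 -> 0 < L <= 1 -> 0 < eta ->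
  (forall c, in_disc c -> exists n, beta (Z n) c < R1) ->
  (forall z w, in_disc z -> in_disc w -> beta (f z) (f w) <= L * beta z w) ->
  (forall n m, beta (f (Z n)) (f (Z m)) <= eta * L * beta (Z n) (Z m)) ->
  f (Z n0) = 0 -> beta (Z n0) z0 < R1 -> beta w0 z0 < 8 * R1 ->
  let tau := hyp_inv (8 * R1) in
  let theta := hyp_inv R1 / tau in
  let T := (INR k + 1) * (8 * R1) in
  theta ^ k * (R1 + 1) <= tau / 64 ->
  eta * (T + 2 * R1) <= (1 - theta) * tau / 128 ->
  beta (f z0) (f w0) <= L / 2 * beta z0 w0.
Proof.
  intros [Hf Hfd] HZ Hz0 Hw0 HR1 HL Heta Hdense HLip HZq Hn0 Hz0n0 Hw0z0 tau theta T Hk Hd.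
  pose proof (hyp_inv_range (8 * R1) ltac:(lra)) as Htau. fold tau in Htau.
  pose proof (hyp_inv_range R1 HR1) as Hth0.
  pose proof (hyp_inv_increasing R1 (8 * R1) ltac:(lra)) as Hth1. fold tau in Hth1.
  assert (Hth : 0 < theta < 1).
  { split; [apply Rdiv_lt_0_compat; lra|]. apply Rlt_div_l; lra. }
  set (delta := eta * (T + 2 * R1)) in *.
  assert (HT : 0 < T) by (unfold T; pose proof (pos_INR k); nra).
  assert (Hdelta : 0 < delta) by (unfold delta; nra).
  assert (Hdelta1 : delta <= 1).
  { eapply Rle_trans; [exact Hd|]. apply Rle_div_l; nra. }
  (* A sequence point near [z] is within [T + 2 * R1] of the zero [Z n0], so [f] is at most
     [L * delta] there; going on to [z] costs at most [L * R1]. *)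
  assert (Hnear : forall z, in_disc z -> beta z z0 < T -> Cmod (f z) <= L * (R1 + 1) /\
     exists w, in_disc w /\ beta w z < R1 /\ Cmod (f w) <= L * delta).
  { intros z Hz Hzb. destruct (Hdense z Hz) as [n Hn].
    pose proof (HZ n) as HZn. pose proof (HZ n0) as HZn0.
    assert (Hnn0 : beta (Z n) (Z n0) <= T + 2 * R1).
    { pose proof (beta_triangle (Z n) z (Z n0) HZn Hz HZn0).
      pose proof (beta_triangle z z0 (Z n0) Hz Hz0 HZn0).
      rewrite (beta_sym z0 (Z n0)) in * by assumption. lra. }
    assert (Hfn : beta (f (Z n)) 0 <= L * delta).
    { rewrite <- Hn0. eapply Rle_trans; [apply HZq|].
      replace (L * delta) with (eta * L * (T + 2 * R1)) by (unfold delta; ring).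
      apply Rmult_le_compat_l; [nra|exact Hnn0]. }
    assert (Hb0 : forall v, in_disc v -> Cmod v <= beta v 0).
    { intros v Hv. rewrite <- rho_0_r. apply rho_le_beta; [exact Hv|apply in_disc_0]. }
    pose proof (Hfd z Hz) as Hfz. pose proof (Hfd _ HZn) as HfZn.
    split.
    - eapply Rle_trans; [now apply Hb0|].
      pose proof (beta_triangle (f z) (f (Z n)) 0 Hfz HfZn in_disc_0) as Htr.
      pose proof (HLip z (Z n) Hz HZn) as Hl. rewrite (beta_sym z (Z n)) in Hl by assumption.
      assert (L * beta (Z n) z <= L * R1) by (apply Rmult_le_compat_l; lra).
      assert (L * delta <= L * 1) by (apply Rmult_le_compat_l; lra). lra.
    - exists (Z n). split; [exact HZn|]. split; [exact Hn|].
      eapply Rle_trans; [now apply Hb0|exact Hfn]. }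
  assert (Hball : forall v, in_disc v -> beta v z0 < 8 * R1 -> Cmod (f v) <= L * tau / 32).
  { intros v Hv Hvb.
    eapply Rle_trans;
      [apply (decay f z0 R1 (8 * R1) T (L * (R1 + 1)) (L * delta)) with (k := k);
       [exact Hf|exact Hz0|lra|nra|nra|exact Hnear|exact Hv|unfold T; lra]|].
    fold tau. fold theta.
    assert (H1 : 2 * (L * delta) / (1 - theta) <= L * (tau / 64)).
    { apply Rle_div_l; [lra|]. nra. }
    assert (H2 : L * (theta ^ k * (R1 + 1)) <= L * (tau / 64))
      by (apply Rmult_le_compat_l; lra).
    lra. }
  set (m := L * tau / 32) in *.
  assert (Hm : 0 < m <= 1 / 32) by (unfold m; nra).
  assert (Hr : rho w0 z0 < tau) by (apply rho_lt_hyp_inv; try assumption; lra).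
  assert (Hs : Cmod (f z0 - f w0) <= rho w0 z0 / tau * (m + Cmod (f w0))).
  { apply local_schwarz_pick; try assumption; try lra.
    intros v Hv Hvr. apply Hball; [exact Hv|]. apply rho_lt_hyp_inv in Hvr; try assumption; lra. }
  assert (Hfw : Cmod (f w0) <= m) by (apply Hball; assumption).
  assert (Hfz : Cmod (f z0) <= m) by (apply Hball; [assumption|rewrite beta_self; lra]).
  pose proof (rho_ge0 w0 z0) as Hr0. pose proof (Cmod_ge_0 (f w0)). pose proof (Cmod_ge_0 (f z0)).
  assert (Hs2 : Cmod (f z0 - f w0) <= L * rho w0 z0 / 16).
  { eapply Rle_trans; [exact Hs|].
    replace (L * rho w0 z0 / 16) with (rho w0 z0 / tau * (2 * m)) by (unfold m; field; lra).
    apply Rmult_le_compat_l; [apply Rle_div_r; lra|lra]. }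
  assert (Hrf : rho (f z0) (f w0) <= L * rho w0 z0 / 8).
  { unfold rho at 1. pose proof (Cmod_one_minus (f w0) (f z0)) as Hden.
    assert (Hden2 : 1 / 2 <= Cmod (1 - Cconj (f w0) * f z0)) by nra.
    rewrite Cmod_div by (apply Cmod_gt_0; lra). apply Rle_div_l; [lra|].
    rewrite Cmod_minus_sym. eapply Rle_trans; [exact Hs2|].
    assert (0 <= L * rho w0 z0) by nra. nra. }
  pose proof (rho_ge0 (f z0) (f w0)).
  rewrite beta_hyp. eapply Rle_trans; [apply hyp_le_4; split; [assumption|nra]|].
  rewrite (beta_sym z0 w0) by assumption.
  pose proof (rho_le_beta w0 z0 Hw0 Hz0). nra.
Qed.

(** [eta] depends on [R1] alone, which makes the sampling constant uniform in [f]. *)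
Lemma dense_contraction (R1 : R) : 0 < R1 -> exists eta, 0 < eta < 1 /\
  forall (Z : nat -> C) (f : C -> C) (L : R), self_map f -> (forall n, in_disc (Z n)) ->
  0 < L <= 1 ->
  (forall c, in_disc c -> exists n, beta (Z n) c < R1) ->
  (forall z w, in_disc z -> in_disc w -> beta (f z) (f w) <= L * beta z w) ->
  (forall n m, beta (f (Z n)) (f (Z m)) <= eta * L * beta (Z n) (Z m)) ->
  forall z w, in_disc z -> in_disc w -> beta (f z) (f w) <= L / 2 * beta z w.
Proof.
  intros HR1.
  pose proof (hyp_inv_range (8 * R1) ltac:(lra)) as Htau.
  pose proof (hyp_inv_range R1 HR1) as Hth0.
  pose proof (hyp_inv_increasing R1 (8 * R1) ltac:(lra)) as Hth1.
  set (tau := hyp_inv (8 * R1)) in *. set (theta := hyp_inv R1 / tau).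
  assert (Hth : 0 < theta < 1).
  { split; [apply Rdiv_lt_0_compat; lra|]. apply Rlt_div_l; lra. }
  destruct (pow_lt_1_zero theta ltac:(rewrite Rabs_pos_eq; lra) (tau / 64 / (R1 + 1)))
    as [k Hk].
  { apply Rdiv_lt_0_compat; lra. }
  specialize (Hk k (le_n k)). rewrite Rabs_pos_eq in Hk by (apply pow_le; lra).
  apply Rlt_div_r in Hk; [|lra].
  set (T := (INR k + 1) * (8 * R1)).
  assert (HT : 0 < T) by (unfold T; pose proof (pos_INR k); nra).
  (* The [1 / 5] serves the distant pairs, the other bound the near pairs. *)
  set (eta := Rmin (1 / 5) ((1 - theta) * tau / 128 / (T + 2 * R1))).
  assert (Heta : 0 < eta).
  { apply Rmin_pos; [lra|]. apply Rdiv_lt_0_compat; [nra|lra]. }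
  assert (Heta1 : eta <= 1 / 5) by apply Rmin_l.
  assert (Heta2 : eta * (T + 2 * R1) <= (1 - theta) * tau / 128).
  { apply Rle_div_r; [lra|]. apply Rmin_r. }
  exists eta. split; [lra|].
  intros Z f L Hf HZ HL Hdense HLip HZq z w Hz Hw.
  destruct (Hdense z Hz) as [n Hn]. destruct (Rlt_le_dec (beta w z) (8 * R1)) as [Hlt|Hge].
  (* Near pairs: composing with [mob a] makes the function vanish at [Z n] and leaves all distances
     between values unchanged. *)
  - set (a := f (Z n)). assert (Ha : in_disc a) by apply (proj2 Hf), HZ.
    set (g := fun u => mob a (f u)).
    assert (Hg : self_map g) by (apply (self_map_comp (mob a) f);
      [now apply self_map_mob|exact Hf]).
    assert (Hgb : forall u v, in_disc u -> in_disc v -> beta (g u) (g v) = beta (f u) (f v)).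
    { intros u v Hu Hv. apply beta_mob_invariant; [exact Ha|now apply (proj2 Hf)..]. }
    rewrite <- (Hgb z w Hz Hw).
    apply (near_pair_contraction g Z n k z w R1 L eta); try assumption.
    + intros u v Hu Hv. rewrite Hgb by assumption. now apply HLip.
    + intros i j. rewrite Hgb by apply HZ. apply HZq.
    + apply mob_self.
    + fold tau. fold theta. lra.
  (* Distant pairs, through the sequence points [Z n] and [Z m]: since [R1 <= D / 8], the total is
     at most [L * (D / 4 + (1 / 5) * (5 * D / 4)) = L * D / 2]. *)
  - destruct (Hdense w Hw) as [m Hm]. rewrite (beta_sym w z Hw Hz) in Hge.
    pose proof (HZ n) as HZn. pose proof (HZ m) as HZm.
    pose proof (proj2 Hf) as Hfd.
    pose proof (beta_triangle (f z) (f (Z n)) (f w) (Hfd _ Hz) (Hfd _ HZn) (Hfd _ Hw)).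
    pose proof (beta_triangle (f (Z n)) (f (Z m)) (f w) (Hfd _ HZn) (Hfd _ HZm) (Hfd _ Hw)).
    pose proof (beta_triangle (Z n) z (Z m) HZn Hz HZm).
    pose proof (beta_triangle z w (Z m) Hz Hw HZm).
    pose proof (HLip z (Z n) Hz HZn) as B1. pose proof (HLip (Z m) w HZm Hw) as B2.
    rewrite (beta_sym z (Z n)) in B1 by assumption.
    rewrite (beta_sym w (Z m)) in * by assumption.
    pose proof (HZq n m) as B3.
    set (D := beta z w) in *.
    assert (B1' : L * beta (Z n) z <= L * R1) by (apply Rmult_le_compat_l; lra).
    assert (B2' : L * beta (Z m) w <= L * R1) by (apply Rmult_le_compat_l; lra).
    assert (B3' : eta * L * beta (Z n) (Z m) <= 1 / 5 * L * (D + 2 * R1)).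
    { apply Rmult_le_compat; [nra|now apply beta_ge0|nra|lra]. }
    assert (L * (8 * R1) <= L * D) by (apply Rmult_le_compat_l; lra). lra.
Qed.

(** * Sampling sequences are dense *)

Lemma N_seq_nonneg (Z : nat -> C) (f : C -> C) : weak_self_map f ->
  (forall n, in_disc (Z n)) -> (forall n m, n <> m -> Z n <> Z m) ->
  Rbar_le (Finite 0) (N_seq Z f).
Proof.
  intros Hf HZ Hdist.
  apply Rbar_le_trans with (Finite (beta (f (Z 0%nat)) (f (Z 1%nat)) / beta (Z 0%nat) (Z 1%nat))).
  - simpl. pose proof (beta_contraction f _ _ Hf (HZ 0%nat) (HZ 1%nat)) as [Hb _].
    apply Rle_div_r; [|lra]. apply beta_pos; auto.
  - unfold N_seq. apply Lub_Rbar_correct. exists 0%nat, 1%nat. now split.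
Qed.

(** If the sampling inequality failed for [eta], the contraction would make [L / 2] a Lipschitz
    constant, against the minimality of [L > 0]. *)
Lemma sampling_of_dense (Z : nat -> C) (Rad : R) :
  (forall n, in_disc (Z n)) -> (forall n m, n <> m -> Z n <> Z m) ->
  0 < Rad -> R_dense Z Rad -> sampling Z.
Proof.
  intros HZ Hdist HRad Hdense.
  (* [R_dense] speaks of radii strictly above [Rad], hence [Rad + 1]. *)
  destruct (dense_contraction (Rad + 1) ltac:(lra)) as [eta [Heta Hcontr]].
  exists eta. split; [exact Heta|]. intros f Hf. apply in_U_weak_self_map in Hf.
  destruct (N_finite f Hf) as [L [-> [HL [HLip HLmin]]]].
  pose proof (N_seq_nonneg Z f Hf HZ Hdist) as H0.
  change (Rbar_mult eta L) with (Finite (eta * L)).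
  destruct (Req_dec L 0) as [->|HL0]; [now rewrite Rmult_0_r|].
  apply Rbar_not_lt_le. intros Hlt.
  assert (HZq : forall n m, beta (f (Z n)) (f (Z m)) <= eta * L * beta (Z n) (Z m)).
  { intros n m. destruct (Nat.eq_dec n m) as [->|Hne]; [rewrite !beta_self; lra|].
    pose proof (beta_pos _ _ (HZ n) (HZ m) (Hdist n m Hne)) as Hp.
    apply Rle_div_l; [exact Hp|].
    assert (Hr : Rbar_le (Finite (beta (f (Z n)) (f (Z m)) / beta (Z n) (Z m))) (N_seq Z f)).
    { unfold N_seq. apply Lub_Rbar_correct. now exists n, m. }
    pose proof (Rbar_le_lt_trans _ _ _ Hr Hlt) as Hr2. simpl in Hr2. lra. }
  assert (Hhalf : L <= L / 2); [|lra].
  apply HLmin. intros z w Hz Hw.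
  destruct (self_map_or_constant f Hf) as [Hs|Hc].
  - apply (Hcontr Z f L); try assumption; try lra.
    intros c Hc. apply Hdense; [exact Hc|lra].
  - rewrite (Hc z w Hz Hw), beta_self. pose proof (beta_ge0 z w Hz Hw). nra.
Qed.

Lemma hyp_ge_ln (x : R) : 0 <= x < 1 -> ln (/ (1 - x)) <= hyp x.
Proof.
  intros Hx. unfold hyp. apply ln_le; [apply Rinv_0_lt_compat; lra|].
  unfold Rdiv. rewrite <- (Rmult_1_l (/ (1 - x))) at 1.
  apply Rmult_le_compat_r; [left; apply Rinv_0_lt_compat|]; lra.
Qed.

(* With [d = |p - q|], [|1 - conj q p| <= 2 eta + d], so [beta p q >= ln (1 + d / (2 eta))]. *)
Lemma dist_small_near_boundary (eps : R) : 0 < eps -> exists eta, 0 < eta < 1 /\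
  forall p q : C, in_disc p -> in_disc q -> 1 - eta <= Cmod q ->
  Cmod (p - q) <= eps * beta p q.
Proof.
  intros Heps. pose proof (exp_pos (2 / eps)) as HK. set (K := exp (2 / eps)) in *.
  assert (H0 : 0 < eps / (4 * K)) by (apply Rdiv_lt_0_compat; lra).
  (* If [d <= eps / 2], then [eta <= eps / 4] gives [d <= rho * eps]. Otherwise
     [eta <= eps / (4 * K)] gives [1 - rho <= 1 / K], so [beta >= ln K = 2 / eps], and [d <= 2]
     suffices. *)
  set (eta := Rmin (1 / 2) (Rmin (eps / 4) (eps / (4 * K)))).
  assert (Heta : 0 < eta) by (repeat apply Rmin_pos; lra).
  assert (He1 : eta <= 1 / 2) by apply Rmin_l.
  assert (He2 : eta <= eps / 4) by (eapply Rle_trans; [apply Rmin_r|apply Rmin_l]).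
  assert (He3 : eta <= eps / (4 * K)) by (eapply Rle_trans; [apply Rmin_r|apply Rmin_r]).
  exists eta. split; [lra|]. intros p q Hp Hq Hq1.
  pose proof (rho_ge0 p q) as Hr0. pose proof (rho_lt1 p q Hp Hq) as Hr1.
  set (d := Cmod (p - q)).
  assert (Hd0 : 0 <= d) by apply Cmod_ge_0.
  pose proof (Cmod_minus_le p q) as Hd2. fold d in Hd2.
  pose proof (Cmod_ge_0 q) as Hq0.
  pose proof Hp as Hp1. pose proof Hq as Hq2. unfold in_disc in Hp1, Hq2.
  assert (Hden : Cmod (1 - Cconj q * p) <= 2 * eta + d).
  { replace (1 - Cconj q * p)%C with (RtoC (1 - Cmod q ^ 2) + Cconj q * (q - p))%C.
    - eapply Rle_trans; [apply Cmod_triangle|].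
      rewrite Cmod_mult, Cmod_conj, (Cmod_minus_sym q p), Cmod_R, Rabs_pos_eq by nra.
      fold d. nra.
    - rewrite RtoC_minus, Cmod2_conj. ring. }
  pose proof (den_pos q p Hq2 ltac:(lra)) as Hdp.
  assert (Hrho : d <= rho p q * (2 * eta + d)).
  { apply Rle_trans with (rho p q * Cmod (1 - Cconj q * p)).
    - right. unfold rho. rewrite Cmod_div by (apply Cmod_gt_0; lra).
      rewrite Cmod_minus_sym. fold d. field. lra.
    - apply Rmult_le_compat_l; assumption. }
  destruct (Rle_lt_dec d (eps / 2)) as [Hs|Hl].
  - pose proof (rho_le_beta p q Hp Hq). nra.
  - assert (Hinv : K <= / (1 - rho p q)).
    { rewrite <- (Rinv_inv K). apply Rinv_le_contravar; [lra|].
      rewrite <- Rdiv_1_l. apply Rle_div_r; [exact HK|].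
      apply Rle_div_r in He3; [|lra].
      assert ((1 - rho p q) * (2 * eta + d) <= 2 * eta) by lra.
      assert ((1 - rho p q) * d <= 2 * eta) by nra.
      assert ((1 - rho p q) * (eps / 2) <= 2 * eta) by nra.
      assert ((1 - rho p q) * (eps / 2) * K <= 2 * eta * K) by nra. nra. }
    pose proof (hyp_ge_ln (rho p q) ltac:(lra)) as Hb. rewrite <- beta_hyp in Hb.
    assert (Hln : 2 / eps <= ln (/ (1 - rho p q))).
    { rewrite <- (ln_exp (2 / eps)). apply ln_le; assumption. }
    assert (2 / eps * eps = 2) by (field; lra). nra.
Qed.

(** After scaling, the denominator in [rho] is at least [1 / 2], so [rho <= |p - q| / 4 <= 1 / 2]
    and [hyp_le_4] applies. *)
Lemma beta_eighth_le (p q : C) : in_disc p -> in_disc q ->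
  beta (RtoC (1 / 8) * p)%C (RtoC (1 / 8) * q)%C <= Cmod (p - q).
Proof.
  unfold in_disc. intros Hp Hq. pose proof (Cmod_ge_0 p) as Hp0. pose proof (Cmod_ge_0 q) as Hq0.
  pose proof (Cmod_minus_le p q) as Hd. pose proof (Cmod_ge_0 (p - q)) as Hd0.
  assert (Hsc : forall z, Cmod (RtoC (1 / 8) * z) = 1 / 8 * Cmod z)
    by (intros z; rewrite Cmod_mult, Cmod_R, Rabs_pos_eq; lra).
  assert (Hr : rho (RtoC (1 / 8) * p)%C (RtoC (1 / 8) * q)%C <= Cmod (p - q) / 4).
  { unfold rho. pose proof (Cmod_one_minus (RtoC (1 / 8) * q) (RtoC (1 / 8) * p)) as Hden.
    rewrite !Hsc in Hden.
    assert (Hden2 : 1 / 2 <= Cmod (1 - Cconj (RtoC (1 / 8) * q) * (RtoC (1 / 8) * p))) by nra.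
    rewrite Cmod_div by (apply Cmod_gt_0; lra). apply Rle_div_l; [lra|].
    replace (RtoC (1 / 8) * q - RtoC (1 / 8) * p)%C with (RtoC (1 / 8) * (q - p))%C by ring.
    rewrite Hsc, Cmod_minus_sym. nra. }
  rewrite beta_hyp. eapply Rle_trans; [apply hyp_le_4|lra].
  split; [apply rho_ge0|lra].
Qed.

Lemma dense_of_sampling (Z : nat -> C) :
  (forall n, in_disc (Z n)) -> (forall n m, n <> m -> Z n <> Z m) ->
  sampling Z -> exists Rad, 0 < Rad /\ R_dense Z Rad.
Proof.
  intros HZ Hdist [c [Hc Hsamp]].
  assert (Hreal : forall x, 0 <= x < 1 -> in_disc (RtoC x)).
  { intros x Hx. unfold in_disc. rewrite Cmod_R, Rabs_pos_eq; lra. }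
  assert (Hne : forall x, 0 < x -> RtoC x <> 0) by (intros x Hx E; apply RtoC_inj in E; lra).
  pose proof (Hreal (1 / 2) ltac:(lra)) as Hd2. pose proof (Hreal (1 / 16) ltac:(lra)) as Hd16.
  pose proof (beta_pos _ _ Hd2 in_disc_0 (Hne (1 / 2) ltac:(lra))) as Hb2.
  pose proof (beta_pos _ _ Hd16 in_disc_0 (Hne (1 / 16) ltac:(lra))) as Hb16.
  (* The ratio of [z / 8] at the pair [1 / 2], 0. Pulled back by [mob (- a)], it is a lower bound
     for [N (mob a / 8)] that does not depend on [a]. *)
  set (kappa := beta (RtoC (1 / 16)) 0 / beta (RtoC (1 / 2)) 0).
  assert (Hk : 0 < kappa) by now apply Rdiv_lt_0_compat.
  destruct (dist_small_near_boundary (c * kappa / 2)) as [eta [Heta Hsmall]]; [nra|].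
  assert (Hh : 0 < hyp (1 - eta)).
  { rewrite <- hyp_0. apply hyp_lt; lra. }
  (* A disc of larger radius about [a] that misses the sequence forces [rho (Z n) a >= 1 - eta] for
     all [n]. *)
  exists (hyp (1 - eta)). split; [exact Hh|].
  intros a r Ha Hr. apply NNPP. intros Hno.
  assert (Hfar : forall n, 1 - eta <= Cmod (mob a (Z n))).
  { intros n. rewrite <- rho_mob. pose proof (rho_ge0 (Z n) a).
    destruct (Rle_lt_dec (1 - eta) (rho (Z n) a)) as [|Hlt]; [assumption|].
    exfalso. apply Hno. exists n. rewrite beta_hyp.
    pose proof (hyp_lt (rho (Z n) a) (1 - eta) ltac:(lra) Hlt ltac:(lra)). lra. }
  set (f := fun z => (RtoC (1 / 8) * mob a z)%C).
  assert (Hf : weak_self_map f).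
  { split; [apply holo_scale, self_map_mob, Ha|].
    intros z Hz. unfold f. rewrite Cmod_mult, Cmod_R, Rabs_pos_eq by lra.
    pose proof (mob_in_disc a z Ha Hz) as H. unfold in_disc in H. lra. }
  assert (Hup : Rbar_le (N_seq Z f) (Finite (c * kappa / 2))).
  { unfold N_seq. apply Lub_Rbar_correct. intros x [n [m [Hnm ->]]]. simpl.
    apply Rle_div_l; [apply beta_pos; auto|]. unfold f.
    eapply Rle_trans; [apply beta_eighth_le; now apply mob_in_disc|].
    rewrite <- (beta_mob_invariant a (Z n) (Z m)) by auto.
    apply Hsmall; [apply mob_in_disc; auto..|apply Hfar]. }
  assert (Hlow : Rbar_le (Finite kappa) (Defs.N f)).
  { unfold Defs.N. apply Lub_Rbar_correct.
    pose proof (in_disc_opp a Ha) as Ha'.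
    exists (mob (- a) (RtoC (1 / 2))), (mob (- a) 0).
    split; [now apply mob_in_disc|]. split; [apply mob_in_disc; [exact Ha'|apply in_disc_0]|].
    unfold f. rewrite !mob_mob_opp by (exact Ha || exact Hd2 || exact in_disc_0).
    split.
    - intros E. apply (Hne (1 / 2)); [lra|].
      rewrite <- (mob_mob_opp a (RtoC (1 / 2)) Ha Hd2), E.
      apply mob_mob_opp; [exact Ha|apply in_disc_0].
    - rewrite beta_mob_invariant by (exact Ha' || exact Hd2 || exact in_disc_0).
      unfold kappa. f_equal. f_equal.
      + rewrite <- RtoC_mult. f_equal. field.
      + ring. }
  (* The contradiction is [c * kappa <= c * L <= c * kappa / 2]. *)
  destruct (N_finite f Hf) as [L [HL _]].
  pose proof (Hsamp f (proj2 (in_U_weak_self_map f) Hf)) as HS.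
  pose proof (Rbar_le_trans _ _ _ HS Hup) as H. rewrite HL in H, Hlow. simpl in H, Hlow.
  nra.
Qed.

Theorem theorem2 (Z : nat -> C)
  (HZ : forall n : nat, in_disc (Z n))
  (Hdist : forall n m : nat, n <> m -> Z n <> Z m) :
  sampling Z <-> exists Rad : R, 0 < Rad /\ R_dense Z Rad.
Proof.
  split.
  - now apply dense_of_sampling.
  - intros [Rad [HRad Hdense]]. now apply (sampling_of_dense Z Rad).
Qed.
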